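(* Let $d\ge1$ be an integer and let $\mathcal{C}$ be a Krull-Schmidt triangulated category with a Serre functor $\nu$. Put $\nu_d:=\nu\circ[-d]$. Assume that $\mathcal{C}$ has a $d$-cluster tilting subcategory which has an additive generator (respectively, a $\nu_d$-additive generator). Then each $d$-cluster tilting subcategory of $\mathcal{C}$ has an additive generator (respectively, a $\nu_d$-additive generator).
   Context: Triangulated categories with Serre functor are $k$-linear ($k$ a field) and Hom-finite; a Serre functor is a $k$-linear autoequivalence $\nu$ with functorial isomorphisms $D\mathrm{Hom}(X,Y)\simeq\mathrm{Hom}(Y,\nu X)$, $D=\mathrm{Hom}_k(-,k)$. A subcategory $\mathcal{U}\subset\mathcal{C}$ is $d$-cluster tilting if it is functorially finite and $\mathcal{U}=\{X\mid \mathrm{Hom}(\mathcal{U},X[i])=0,\ 1\le i\le d-1\}=\{X\mid \mathrm{Hom}(X,\mathcal{U}[i])=0,\ 1\le i\le d-1\}$. An object $U\in\mathcal{U}$ is an additive generator of $\mathcal{U}$ if $\mathcal{U}=\mathrm{add}\,U$, and a $\nu_d$-additive generator if $\mathcal{U}=\mathrm{add}\{\nu_d^i(U)\mid i\in\mathbb{Z}\}$. *)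

(* Defs.v *)
From HB Require Import structures.
From mathcomp Require Import all_boot all_order all_algebra.

Set Implicit Arguments.
Unset Strict Implicit.
Unset Printing Implicit Defensive.

Import GRing.Theory.
Local Open Scope ring_scope.

Declare Scope cat_scope.
Delimit Scope cat_scope with cat.
Local Open Scope cat_scope.

(* Hom-finiteness is built in: a [vectType] is a finite-dimensional vector
   space. *)
Record linCat (k : fieldType) := LinCat {
  obj :> Type;
  mor : obj -> obj -> vectType k;
  idm : forall X, mor X X;
  mcomp : forall X Y Z, mor Y Z -> mor X Y -> mor X Z;
  compA : forall X Y Z W (h : mor Z W) (g : mor Y Z) (f : mor X Y),
    mcomp h (mcomp g f) = mcomp (mcomp h g) f;
  comp1m : forall X Y (f : mor X Y), mcomp (idm Y) f = f;
  compm1 : forall X Y (f : mor X Y), mcomp f (idm X) = f;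
  comp_linearr : forall X Y Z (g : mor Y Z), linear (@mcomp X Y Z g);
  comp_linearl : forall X Y Z (f : mor X Y),
    linear (fun g : mor Y Z => mcomp g f)
}.

Arguments mor {k l} X Y.
Arguments idm {k l} X.
Arguments mcomp {k l X Y Z} g f.

Notation "g ∘ f" := (mcomp g f) (at level 40, left associativity) : cat_scope.

Definition precomp (k : fieldType) (C : linCat k) (X Y Z : C) (f : mor X Y)
  (g : mor Y Z) : mor X Z := g ∘ f.

HB.instance Definition _ (k : fieldType) (C : linCat k) (X Y Z : C)
    (g : mor Y Z) :=
  GRing.isLinear.Build k (mor X Y) (mor X Z) *:%R (mcomp g)
    (@comp_linearr k C X Y Z g).

HB.instance Definition _ (k : fieldType) (C : linCat k) (X Y Z : C)
    (f : mor X Y) :=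
  GRing.isLinear.Build k (mor Y Z) (mor X Z) *:%R (@precomp k C X Y Z f)
    (@comp_linearl k C X Y Z f).

Section LinearCategories.
Variables (k : fieldType) (C : linCat k).
Implicit Types (X Y S : C) (U V : C -> Prop).

Definition is_iso X Y (f : mor X Y) : Prop :=
  exists g : mor Y X, g ∘ f = idm X /\ f ∘ g = idm Y.

Definition is_dsum (I : finType) (A : I -> C) S : Prop :=
  exists (inj : forall i, mor (A i) S) (proj : forall i, mor S (A i)),
    [/\ forall i, proj i ∘ inj i = idm (A i),
        forall i j, i != j -> proj j ∘ inj i = 0
      & \sum_i (inj i ∘ proj i) = idm S].

(* For n = 0 this provides a zero object. *)
Definition has_finite_dsums : Prop :=
  forall (n : nat) (A : 'I_n -> C), exists S, is_dsum A S.

Definition is_summand X S : Prop :=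
  exists Y, is_dsum (fun b : bool => if b then X else Y) S.

Definition add_closure U X : Prop :=
  exists (n : nat) (A : 'I_n -> C) (S : C),
    [/\ forall i, U (A i), is_dsum A S & is_summand X S].

Definition has_local_end X : Prop :=
  idm X <> 0 /\
  forall f g : mor X X, ~ is_iso f -> ~ is_iso g -> ~ is_iso (f + g).

Definition krull_schmidt : Prop :=
  forall X, exists (n : nat) (A : 'I_n -> C),
    (forall i, has_local_end (A i)) /\ is_dsum A X.

(* A subcategory is full, hence given by its class of objects. *)
Definition contravariantly_finite U : Prop :=
  forall X, exists (Y : C) (f : mor Y X),
    U Y /\ forall (Z : C) (g : mor Z X), U Z -> exists h : mor Z Y, g = f ∘ h.

Definition covariantly_finite U : Prop :=
  forall X, exists (Y : C) (f : mor X Y),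
    U Y /\ forall (Z : C) (g : mor X Z), U Z -> exists h : mor Y Z, g = h ∘ f.

Definition functorially_finite U : Prop :=
  contravariantly_finite U /\ covariantly_finite U.

End LinearCategories.

Record linFunctor (k : fieldType) (C D : linCat k) := LinFunctor {
  fobj :> C -> D;
  fmap : forall X Y, {linear mor X Y -> mor (fobj X) (fobj Y)};
  fmap1 : forall X, fmap X X (idm X) = idm (fobj X);
  fmapM : forall X Y Z (g : mor Y Z) (f : mor X Y),
    fmap X Z (g ∘ f) = fmap Y Z g ∘ fmap X Y f
}.

Arguments fmap {k C D} l {X Y}.

Section Functors.
Variable k : fieldType.

Definition fid (C : linCat k) : linFunctor C C.
Proof. by exists id (fun X Y => idfun : {linear mor X Y -> mor X Y}). Defined.

Definition fcomp (C D E : linCat k) (G : linFunctor D E) (F : linFunctor C D) :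
  linFunctor C E.
Proof.
exists (fun X => G (F X))
  (fun X Y => (fmap G \o fmap F : {linear mor X Y -> mor (G (F X)) (G (F Y))})).
- by move=> X /=; rewrite !fmap1.
- by move=> X Y Z g f /=; rewrite !fmapM.
Defined.

Definition nat_iso (C D : linCat k) (F G : linFunctor C D) : Prop :=
  exists (t : forall X, mor (F X) (G X)) (t' : forall X, mor (G X) (F X)),
    [/\ forall (X Y : C) (f : mor X Y), t Y ∘ fmap F f = fmap G f ∘ t X,
        forall X, t' X ∘ t X = idm (F X)
      & forall X, t X ∘ t' X = idm (G X)].

Variable C : linCat k.

(* An autoequivalence together with a chosen quasi-inverse, so that its
   negative powers are defined on objects. *)
Record autoEquiv := AutoEquiv {
  aeq_fun :> linFunctor C C;
  aeq_qinv : linFunctor C C;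
  aeq_unit : nat_iso (fid C) (fcomp aeq_qinv aeq_fun);
  aeq_counit : nat_iso (fcomp aeq_fun aeq_qinv) (fid C)
}.

Lemma nat_iso_refl (F : linFunctor C C) : nat_iso F F.
Proof.
by exists (fun X : C => idm (F X)), (fun X : C => idm (F X)); split=> *;
  rewrite ?comp1m ?compm1.
Qed.

Lemma nat_iso_sym (F G : linFunctor C C) : nat_iso F G -> nat_iso G F.
Proof.
move=> [t [t' [tN t't tt']]]; exists t', t; split=> // X Y f.
by rewrite -[fmap G f]compm1 -tt' (compA (fmap G f)) -tN -compA compA compA t't
  comp1m.
Qed.

Lemma nat_iso_unit_comp (F F' G G' : linFunctor C C) :
  nat_iso (fid C) (fcomp F' F) -> nat_iso (fid C) (fcomp G' G) ->
  nat_iso (fid C) (fcomp (fcomp G' F') (fcomp F G)).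
Proof.
move=> [s [s' [sN s's ss']]] [t [t' [tN t't tt']]].
exists (fun X : C => fmap G' (s (G X)) ∘ t X),
       (fun X : C => t' X ∘ fmap G' (s' (G X))); split=> [X Y f|X|X] /=.
- have /= tNf := tN _ _ f; have /= sNf := sN _ _ (fmap G f).
  by rewrite -compA tNf !compA -!fmapM sNf.
- rewrite compA -(compA (t' X)) -fmapM s's /= fmap1 compm1; exact: t't.
- rewrite compA -(compA (fmap G' _) (t X)) tt' /= compm1 -fmapM ss'.
  exact: fmap1.
Qed.

Lemma nat_iso_counit_comp (F F' G G' : linFunctor C C) :
  nat_iso (fcomp F F') (fid C) -> nat_iso (fcomp G G') (fid C) ->
  nat_iso (fcomp (fcomp F G) (fcomp G' F')) (fid C).
Proof.
by move=> /nat_iso_sym Fi /nat_iso_sym Gi; apply/nat_iso_sym/nat_iso_unit_comp.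
Qed.

Definition aeq_id : autoEquiv :=
  @AutoEquiv (fid C) (fid C) (nat_iso_refl (fid C)) (nat_iso_refl (fid C)).

Definition aeq_comp (E F : autoEquiv) : autoEquiv :=
  @AutoEquiv (fcomp E F) (fcomp (aeq_qinv F) (aeq_qinv E))
    (nat_iso_unit_comp (aeq_unit E) (aeq_unit F))
    (nat_iso_counit_comp (aeq_counit E) (aeq_counit F)).

Definition aeq_inv (E : autoEquiv) : autoEquiv :=
  @AutoEquiv (aeq_qinv E) E
    (nat_iso_sym (aeq_counit E)) (nat_iso_sym (aeq_unit E)).

Definition aeq_pow (E : autoEquiv) (i : int) : autoEquiv :=
  match i with
  | Posz n => iter n (aeq_comp E) aeq_id
  | Negz n => iter n.+1 (aeq_comp (aeq_inv E)) aeq_id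
  end.

End Functors.

(* [dist f g h] : the triangle X -f-> Y -g-> Z -h-> X[1] is distinguished. *)
Record triCat (k : fieldType) := TriCat {
  tri_cat :> linCat k;
  tri_additive : has_finite_dsums tri_cat;
  sh : autoEquiv tri_cat;
  dist : forall X Y Z : tri_cat, mor X Y -> mor Y Z -> mor Z (sh X) -> Prop;
  TR1_iso : forall (X Y Z X' Y' Z' : tri_cat)
      (f : mor X Y) (g : mor Y Z) (h : mor Z (sh X))
      (f' : mor X' Y') (g' : mor Y' Z') (h' : mor Z' (sh X'))
      (a : mor X X') (b : mor Y Y') (c : mor Z Z'),
    is_iso a -> is_iso b -> is_iso c ->
    b ∘ f = f' ∘ a -> c ∘ g = g' ∘ b -> fmap sh a ∘ h = h' ∘ c ->
    dist f g h -> dist f' g' h';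
  TR1_id : forall X Z : tri_cat, idm Z = 0 ->
    dist (idm X) (0 : mor X Z) (0 : mor Z (sh X));
  TR1_cone : forall (X Y : tri_cat) (f : mor X Y),
    exists (Z : tri_cat) (g : mor Y Z) (h : mor Z (sh X)), dist f g h;
  TR2 : forall (X Y Z : tri_cat)
      (f : mor X Y) (g : mor Y Z) (h : mor Z (sh X)),
    dist f g h <-> dist g h (- fmap sh f);
  TR3 : forall (X Y Z X' Y' Z' : tri_cat)
      (f : mor X Y) (g : mor Y Z) (h : mor Z (sh X))
      (f' : mor X' Y') (g' : mor Y' Z') (h' : mor Z' (sh X'))
      (a : mor X X') (b : mor Y Y'),
    dist f g h -> dist f' g' h' -> b ∘ f = f' ∘ a ->
    exists c : mor Z Z', c ∘ g = g' ∘ b /\ fmap sh a ∘ h = h' ∘ c;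
  TR4 : forall (X Y Z X' Y' Z' : tri_cat) (f : mor X Y) (g : mor Y Z)
      (p : mor Y Z') (p' : mor Z' (sh X))
      (q : mor Z X') (q' : mor X' (sh Y))
      (r : mor Z Y') (r' : mor Y' (sh X)),
    dist f p p' -> dist g q q' -> dist (g ∘ f) r r' ->
    exists (u : mor Z' Y') (v : mor Y' X'),
      [/\ dist u v (fmap sh p ∘ q'),
          u ∘ p = r ∘ g, r' ∘ u = p', v ∘ r = q & q' ∘ v = fmap sh f ∘ r']
}.

Arguments sh {k} t.
Arguments dist {k t X Y Z}.

Definition shift (k : fieldType) (C : triCat k) (i : int) : autoEquiv C :=
  aeq_pow (sh C) i.

Definition dual (k : fieldType) (V : vectType k) : vectType k := 'Hom(V, k^o).

(* A Serre functor : isomorphisms [serre_iso X Y] from D Hom(X, Y) to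
   Hom(Y, nu X), natural in Y and in X. *)
Record serreFunctor (k : fieldType) (C : linCat k) := SerreFunctor {
  serre_fun :> autoEquiv C;
  serre_iso : forall X Y : C, {linear dual (mor X Y) -> mor Y (serre_fun X)};
  serre_bij : forall X Y : C, bijective (serre_iso X Y);
  serre_natY : forall (X Y Y' : C) (b : mor Y' Y) (xi : dual (mor X Y)),
    serre_iso X Y' (xi \o linfun (mcomp b))%VF = serre_iso X Y xi ∘ b;
  serre_natX : forall (X X' Y : C) (a : mor X X') (xi : dual (mor X Y)),
    serre_iso X' Y (xi \o linfun (precomp a))%VF
      = fmap serre_fun a ∘ serre_iso X Y xi
}.

Section ClusterTilting.
Variables (k : fieldType) (C : triCat k).
Implicit Types (d : nat) (U : C -> Prop) (G X Y : C).

Definition cluster_tilting d U : Prop :=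
  [/\ functorially_finite U,
      forall X, U X <->
        forall i : nat, (1 <= i <= d.-1)%N ->
        forall Y, U Y -> forall f : mor Y (shift C i X), f = 0
    & forall X, U X <->
        forall i : nat, (1 <= i <= d.-1)%N ->
        forall Y, U Y -> forall f : mor X (shift C i Y), f = 0].

Definition nu_ (nu : serreFunctor C) d : autoEquiv C :=
  aeq_comp nu (shift C (- (d%:Z))).

Definition additive_generator U G : Prop :=
  U G /\ forall X, U X <-> add_closure (fun Y => Y = G) X.

Definition nu_additive_generator (nu : serreFunctor C) d U G : Prop :=
  U G /\
  forall X, U X <->
    add_closure (fun Y => exists i : int, Y = aeq_pow (nu_ nu d) i G) X.

End ClusterTilting.

(* Main.v *)
Require Import Defs.
From HB Require Import structures.
From mathcomp Require Import all_boot all_order all_algebra.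
From mathcomp Require Import zify.
(* Imported again so that compA and comp1m denote the category laws rather than
   the functions of the same names about composition of functions. *)
Require Import Defs.

(** Let F * G be the class of the objects X in a triangle A -> X -> B -> A[1]
    with A in F and B in G, and let U be generated by objects g. For a second
    d-cluster tilting subcategory V, left V-approximations give each generator a
    coresolution g -> V^0 -> ... -> V^(d-1) with terms in V. Let F be the
    additive closure of all these terms; the claim is that V = F, which proves
    both statements, since finitely many terms occur for one generator.

    The coresolution says that g lies in F[-(d-1)] * ... * F[-1] * F, and right
    U-approximations show that every object is a retract of some T in
    U * U[1] * ... * U[d-1]. So T is filtered by d consecutive blocks, the j-th
    of which runs through the degrees j-(d-1), ..., j. When a layer F[a] comes
    before a layer F[b] with a >= b, one has 0 <= a - b <= d - 2, so
    Hom(F[b], F[a+1]) = Hom(F, F[a-b+1]) = 0 because F is contained in V. The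
    two layers are thus a direct sum: they can be exchanged, and merged if
    a = b. Sorting the layers puts T in F[-(d-1)] * ... * F * ... * F[d-1].
    If X is in V then Hom(F[-j], X) = 0 = Hom(X, F[j]) for 1 <= j <= d - 1, so
    the identity of X, which factors through T, factors through the only layer
    of degree 0. Hence X is a retract of an object of F
    ([cluster_tilting_generated]). In the formal argument everything is shifted
    by d - 1, so that only non-negative powers of the shift occur.

    For nu_d-additive generators the generators are the nu_d^i(G), and F has to
    be generated by the nu_d^i of finitely many objects. So the coresolution of
    nu_d^i(G) is taken to be the image of the one of G. This is legitimate
    because nu_d preserves V in both directions, by Serre duality
    ([ct_nu], [ct_nu_inv]), and because nu_d maps triangles to triangles up to
    a change of the third map. For the Serre functor the latter is a theorem of
    Bondal and Kapranov ([serre_cones]): the comparison map from a cone of nu(u)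
    to nu of a cone of u is found as the linear functional which represents it,
    and this functional is prescribed on two subspaces where the prescriptions
    agree. *)

Set Implicit Arguments.
Unset Strict Implicit.
Unset Printing Implicit Defensive.

Import GRing.Theory.
Local Open Scope ring_scope.
Local Open Scope cat_scope.

(** * Linear categories: retracts and direct sums *)
Section LinearCategory.
Variables (k : fieldType) (C : linCat k).
Implicit Types X Y Z T S : C.

Lemma comp0m X Y Z (f : mor X Y) : (0 : mor Y Z) ∘ f = 0.
Proof. exact: (linear0 (@precomp k C X Y Z f)). Qed.

Lemma compm0 X Y Z (g : mor Y Z) : g ∘ (0 : mor X Y) = 0.
Proof. exact: (linear0 (@mcomp k C X Y Z g)). Qed.

Lemma compNm X Y Z (g : mor Y Z) (f : mor X Y) : (- g) ∘ f = - (g ∘ f).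
Proof. exact: (linearN (@precomp k C X Y Z f)). Qed.

Lemma compmN X Y Z (g : mor Y Z) (f : mor X Y) : g ∘ (- f) = - (g ∘ f).
Proof. exact: (linearN (@mcomp k C X Y Z g)). Qed.

Lemma compDm X Y Z (g g' : mor Y Z) (f : mor X Y) :
  (g + g') ∘ f = g ∘ f + g' ∘ f.
Proof. exact: (linearD (@precomp k C X Y Z f)). Qed.

Lemma compmD X Y Z (g : mor Y Z) (f f' : mor X Y) :
  g ∘ (f + f') = g ∘ f + g ∘ f'.
Proof. exact: (linearD (@mcomp k C X Y Z g)). Qed.

Lemma compBm X Y Z (g g' : mor Y Z) (f : mor X Y) :
  (g - g') ∘ f = g ∘ f - g' ∘ f.
Proof. by rewrite compDm compNm. Qed.

Lemma compmB X Y Z (g : mor Y Z) (f f' : mor X Y) :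
  g ∘ (f - f') = g ∘ f - g ∘ f'.
Proof. by rewrite compmD compmN. Qed.

Lemma comp_summ (I : finType) X Y Z (g : I -> mor Y Z) (f : mor X Y) :
  (\sum_i g i) ∘ f = \sum_i g i ∘ f.
Proof. exact: (linear_sum (@precomp k C X Y Z f)). Qed.

Lemma comp_msum (I : finType) X Y Z (g : mor Y Z) (f : I -> mor X Y) :
  g ∘ (\sum_i f i) = \sum_i g ∘ f i.
Proof. exact: (linear_sum (@mcomp k C X Y Z g)). Qed.

Lemma iso_idm X : is_iso (idm X).
Proof. by exists (idm X); rewrite comp1m. Qed.

Lemma iso_oppidm X : is_iso (- idm X).
Proof. by exists (- idm X); rewrite compNm compmN opprK comp1m. Qed.

Definition hom0 X Y : Prop := forall f : mor X Y, f = 0.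

Definition retract X S : Prop :=
  exists (i : mor X S) (r : mor S X), r ∘ i = idm X.

Lemma retract_refl X : retract X X.
Proof. by exists (idm X), (idm X); rewrite comp1m. Qed.

Lemma retract_trans X Y Z : retract X Y -> retract Y Z -> retract X Z.
Proof.
move=> [i [r ri]] [j [s sj]]; exists (j ∘ i), (r ∘ s).
by rewrite compA -(compA r) sj compm1.
Qed.

Lemma iso_retract X Y (f : mor X Y) : is_iso f -> retract X Y.
Proof. by move=> [g [gf _]]; exists f, g. Qed.

Lemma iso_retract_sym X Y (f : mor X Y) : is_iso f -> retract Y X.
Proof. by move=> [g [_ fg]]; exists g, f. Qed.

Lemma retract_hom0l X S Y : retract X S -> hom0 S Y -> hom0 X Y.
Proof.
by move=> [i [r ri]] SY f; rewrite -[f]compm1 -ri compA (SY (f ∘ r)) comp0m.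
Qed.

Lemma retract_hom0r X S Y : retract X S -> hom0 Y S -> hom0 Y X.
Proof.
by move=> [i [r ri]] SY f; rewrite -[f]comp1m -ri -compA (SY (i ∘ f)) compm0.
Qed.

Lemma dsum_hom0l (I : finType) (A : I -> C) S Y :
  is_dsum A S -> (forall i, hom0 (A i) Y) -> hom0 S Y.
Proof.
move=> [inj [proj [_ _ sumE]]] AY f.
rewrite -[f]compm1 -sumE comp_msum big1 // => i _.
by rewrite compA (AY i (f ∘ inj i)) comp0m.
Qed.

Lemma summand_retract X S : is_summand X S -> retract X S.
Proof.
move=> [Y [inj [proj [pi _ _]]]].
by exists (inj true), (proj true); exact: (pi true).
Qed.

Lemma dsum_comp (I : finType) (J : I -> finType) (X : I -> C) S
    (A : forall i, J i -> C) :
  is_dsum X S -> (forall i, is_dsum (A i) (X i)) ->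
  is_dsum (fun p : {i : I & J i} => A (tag p) (tagged p)) S.
Proof.
move=> [inj [proj [pi p0 sumE]]] dA.
have [injA {}dA] := fin_all_exists dA.
have [projA {}dA] := fin_all_exists dA.
exists (fun p => inj (tag p) ∘ injA (tag p) (tagged p)),
       (fun p => projA (tag p) (tagged p) ∘ proj (tag p)); split.
- move=> [i j] /=; have [piA _ _] := dA i.
  by rewrite compA -(compA (projA i j)) pi compm1 piA.
- move=> [i j] [i' j'] /= ne.
  rewrite compA -(compA (projA i' j')).
  have [eqi|nei] := eqVneq i i'; last by rewrite p0 // compm0 comp0m.
  move: j' ne; rewrite -eqi => j' ne; have [_ p0A _] := dA i.
  rewrite pi compm1 p0A //; apply: contraNneq ne => ->; exact: eqxx.
- rewrite -sumE -(sig_big_dep xpredT (fun _ => xpredT)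
    (fun i j => inj i ∘ injA i j ∘ (projA i j ∘ proj i))) /=.
  apply: eq_bigr => i _; have [_ _ sumA] := dA i.
  transitivity (inj i ∘ (\sum_j (injA i j ∘ projA i j)) ∘ proj i).
    by rewrite comp_msum comp_summ; apply: eq_bigr => j _; rewrite !compA.
  by rewrite sumA compm1.
Qed.

Lemma dsum_enum (I : finType) (A : I -> C) S :
  is_dsum A S -> is_dsum (fun j : 'I_#|I| => A (enum_val j)) S.
Proof.
move=> [inj [proj [pi p0 sumE]]].
exists (fun j => inj (enum_val j)), (fun j => proj (enum_val j)); split.
- by move=> j; exact: pi.
- by move=> i j ne; apply: p0; apply: contraNneq ne => /enum_val_inj ->.
- rewrite -sumE [RHS](reindex (@enum_val _ I)) //.
  exact: onW_bij (@enum_val_bij I).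
Qed.

Lemma dsum_iso (I : finType) (A : I -> C) S S' (f : mor S S') :
  is_iso f -> is_dsum A S -> is_dsum A S'.
Proof.
move=> [g [gf fg]] [inj [proj [pi p0 sumE]]].
exists (fun i => f ∘ inj i), (fun i => proj i ∘ g); split.
- by move=> i; rewrite compA -(compA (proj i)) gf compm1 pi.
- by move=> i j ne; rewrite compA -(compA (proj j)) gf compm1 p0.
- rewrite -[RHS]fg -[f in RHS]compm1 -sumE comp_msum comp_summ.
  by apply: eq_bigr => i _; rewrite !compA.
Qed.

End LinearCategory.

(** * Autoequivalences of linear categories *)
Section AutoEquivalence.
Variables (k : fieldType) (C : linCat k).
Implicit Types (E : autoEquiv C) (X Y T : C).

Lemma aeq_faithful E X Y : injective (@fmap k C C E X Y).
Proof.
move=> f g Efg; have [t [t' [tN t't _]]] := aeq_unit E.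
have /= tf := tN _ _ f; have /= tg := tN _ _ g.
by rewrite -[f]comp1m -[g]comp1m -t't -!compA tf tg Efg.
Qed.

(** The preimage of g is read off from the unit; that it is mapped to g can be
    tested after the quasi-inverse, which is itself faithful. No compatibility of
    the unit with the counit enters. *)
Lemma aeq_full E X Y (g : mor (E X) (E Y)) : exists f : mor X Y, g = fmap E f.
Proof.
have [t [t' [tN t't tt']]] := aeq_unit E.
exists (t' Y ∘ fmap (aeq_qinv E) g ∘ t X).
apply: (@aeq_faithful (aeq_inv E)) => /=.
have /= tf := tN _ _ (t' Y ∘ fmap (aeq_qinv E) g ∘ t X).
have /= := congr1 (fun h => h ∘ t' X) tf.
rewrite -[in RHS]compA tt' compm1 => <-.
by rewrite -!compA tt' compm1 compA tt' comp1m.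
Qed.

Lemma aeq_esurj E T : exists (T' : C) (i : mor (E T') T), is_iso i.
Proof.
have [t [t' [_ t't tt']]] := aeq_counit E.
exists (aeq_qinv E T), (t T), (t' T); split; [exact: t't | exact: tt'].
Qed.

Lemma hom0_aeq E X Y : hom0 (E X) (E Y) <-> hom0 X Y.
Proof.
split=> XY f.
  by apply: (@aeq_faithful E); rewrite linear0 (XY (fmap E f)).
by have [g ->] := aeq_full f; rewrite (XY g) linear0.
Qed.

Lemma functor_iso (F : linFunctor C C) X Y (f : mor X Y) :
  is_iso f -> is_iso (fmap F f).
Proof.
by move=> [g [gf fg]]; exists (fmap F g); rewrite -!fmapM gf fg !fmap1.
Qed.

Lemma functor_retract (F : linFunctor C C) X Y :
  retract X Y -> retract (F X) (F Y).
Proof.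
by move=> [i [r ri]]; exists (fmap F i), (fmap F r); rewrite -fmapM ri fmap1.
Qed.

Lemma retract_aeq E X Y : retract (E X) (E Y) -> retract X Y.
Proof.
move=> [i [r]]; have [j ->] := aeq_full i; have [s ->] := aeq_full r.
by rewrite -fmapM -fmap1 => /aeq_faithful sj; exists j, s.
Qed.

Lemma dsum_aeq E (I : finType) (A : I -> C) (S : C) :
  is_dsum (fun i => E (A i)) (E S) -> is_dsum A S.
Proof.
move=> [inj [proj [pi p0 sumE]]].
have [inj' def_inj] := fin_all_exists (fun i => aeq_full (inj i)).
have [proj' def_proj] := fin_all_exists (fun i => aeq_full (proj i)).
exists inj', proj'; split.
- move=> i; apply: (@aeq_faithful E).
  by rewrite fmapM -def_inj -def_proj pi fmap1.
- move=> i j ne; apply: (@aeq_faithful E).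
  by rewrite fmapM -def_inj -def_proj p0 // linear0.
- apply: (@aeq_faithful E); rewrite linear_sum fmap1 -sumE.
  by apply: eq_bigr => i _; rewrite /= fmapM -def_inj -def_proj.
Qed.

End AutoEquivalence.

(** * Triangulated categories *)
Section Triangles.
Variables (k : fieldType) (C : triCat k).
Implicit Types A B E W X Y Z T S : C.

Definition empty_family (i : 'I_0) : C :=
  match i with Ordinal _ lt_m0 => False_rect C (Bool.diff_false_true lt_m0) end.

Lemma zero_object : exists O : C, idm O = 0.
Proof.
have [O [inj [proj [_ _ sumE]]]] := tri_additive empty_family.
by exists O; rewrite -sumE big_ord0.
Qed.

Lemma dist_rot X Y Z (u : mor X Y) (v : mor Y Z) (w : mor Z (sh C X)) :
  dist u v w -> dist v w (- fmap (sh C) u).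
Proof. by move/TR2. Qed.

Lemma dist_comp0 X Y Z (u : mor X Y) (v : mor Y Z) (w : mor Z (sh C X)) :
  dist u v w -> v ∘ u = 0.
Proof.
move=> tri; have [O O0] := zero_object.
have [|c [<- _]] := TR3 (a := idm X) (b := u) (TR1_id X O0) tri; first by [].
exact: compm0.
Qed.

(** Rotating a triangle three times changes the signs of all three maps;
    together with this sign change it gives [dist_shE]. *)
Lemma dist_opp12 X Y Z (u : mor X Y) (v : mor Y Z) (w : mor Z (sh C X)) :
  dist u v w -> dist (- u) (- v) w.
Proof.
apply: (TR1_iso (iso_idm X) (iso_oppidm Y) (iso_idm Z)).
- by rewrite compNm comp1m compm1.
- by rewrite compNm compmN opprK comp1m compm1.
- by rewrite fmap1 comp1m compm1.
Qed.

Lemma dist_shE X Y Z (u : mor X Y) (v : mor Y Z) (w : mor Z (sh C X)) :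
  dist u v w <-> dist (fmap (sh C) u) (fmap (sh C) v) (- fmap (sh C) w).
Proof.
rewrite 3!TR2; split=> /dist_opp12; rewrite ?opprK //.
Qed.

Lemma dist_sh_ex X Y Z (u : mor X Y) (v : mor Y Z) (w : mor Z (sh C X)) :
  dist u v w -> exists w', dist (fmap (sh C) u) (fmap (sh C) v) w'.
Proof. by move/dist_shE; exists (- fmap (sh C) w). Qed.

(** Hom(T, -) is exact on a triangle: a map into Y killed by v is a morphism
    to it from the trivial triangle on T. [dist_colift] is the dual. *)
Lemma dist_lift X Y Z (u : mor X Y) (v : mor Y Z) (w : mor Z (sh C X))
    T (b : mor T Y) :
  dist u v w -> v ∘ b = 0 -> exists c : mor T X, b = u ∘ c.
Proof.
move=> /dist_rot tri vb0; have [O O0] := zero_object.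
have /dist_rot triT := TR1_id T O0.
have [|c [_]] := TR3 (a := b) (b := (0 : mor O Z)) triT tri.
  by rewrite vb0 compm0.
have [c' ->] := aeq_full c.
rewrite fmap1 compmN compm1 compNm -fmapM => /oppr_inj/aeq_faithful e.
by exists c'.
Qed.

Lemma dist_colift X Y Z (u : mor X Y) (v : mor Y Z) (w : mor Z (sh C X))
    T (f : mor Y T) :
  dist u v w -> f ∘ u = 0 -> exists g : mor Z T, f = g ∘ v.
Proof.
move=> tri fu0; have [O O0] := zero_object.
have sO0 : idm (sh C O) = 0 by rewrite -fmap1 O0 linear0.
have triT : dist (0 : mor O T) (idm T) (0 : mor T (sh C O)).
  by apply/TR2; rewrite linear0 oppr0; exact: TR1_id.
have [|c [e _]] := TR3 (a := (0 : mor X O)) (b := f) tri triT.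
  by rewrite fu0 compm0.
by exists c; rewrite e comp1m.
Qed.

Lemma dist_sh_lift X Y Z (u : mor X Y) (v : mor Y Z) (w : mor Z (sh C X))
    T (x : mor T (sh C X)) :
  dist u v w -> fmap (sh C) u ∘ x = 0 -> exists y : mor T Z, x = w ∘ y.
Proof.
move=> /dist_rot/dist_rot tri ux0; apply: (dist_lift tri).
by rewrite compNm ux0 oppr0.
Qed.

Lemma dist_sh_colift X Y Z (u : mor X Y) (v : mor Y Z) (w : mor Z (sh C X))
    T (f : mor Z T) :
  dist u v w -> f ∘ v = 0 -> exists g : mor (sh C X) T, f = g ∘ w.
Proof. by move=> /dist_rot tri; apply: (dist_colift tri). Qed.

Lemma dist_comp0_sh X Y Z (u : mor X Y) (v : mor Y Z) (w : mor Z (sh C X)) :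
  dist u v w -> fmap (sh C) u ∘ w = 0.
Proof.
by move=> /dist_rot/dist_rot/dist_comp0/eqP; rewrite compNm oppr_eq0 => /eqP.
Qed.

(** The five lemma, with a target that is only assumed to be exact for
    Hom(T, -). A map from an honest triangle to such a candidate which is the
    identity on X and Y is an isomorphism, so that the candidate is
    distinguished ([dist_of_exact]). Direct sums of triangles and images of
    triangles under the Serre functor are recognized in this way. *)
Lemma cone_map_iso X Y Z W (u : mor X Y) (p : mor Y W) (q : mor W (sh C X))
    (v : mor Y Z) (w : mor Z (sh C X)) (c : mor W Z) :
  dist u p q ->
  (forall T (b : mor T Y), v ∘ b = 0 -> exists x, b = u ∘ x) ->
  (forall T (z : mor T Z), w ∘ z = 0 -> exists b, z = v ∘ b) ->
  fmap (sh C) u ∘ w = 0 -> c ∘ p = v -> w ∘ c = q -> is_iso c.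
Proof.
move=> tri exY exZ uw0 cp wc.
have c_inj T (a : mor T W) : c ∘ a = 0 -> a = 0.
  move=> ca0; have [|b def_a] := dist_lift (b := a) (dist_rot tri).
    by rewrite -wc -compA ca0 compm0.
  have [|x def_b] := exY _ b; first by rewrite -cp -compA -def_a.
  by rewrite def_a def_b compA (dist_comp0 tri) comp0m.
have [a def_w] := dist_sh_lift tri uw0.
have [|b def_b] := exZ _ (idm Z - c ∘ a).
  by rewrite compmB compm1 compA wc -def_w subrr.
have ci : c ∘ (a + p ∘ b) = idm Z.
  by rewrite compmD compA cp -def_b addrC subrK.
exists (a + p ∘ b); split=> //; apply/eqP; rewrite -subr_eq0; apply/eqP.
by apply: c_inj; rewrite compmB compA ci comp1m compm1 subrr.
Qed.

Lemma dist_of_exact X Y Z W (u : mor X Y) (p : mor Y W) (q : mor W (sh C X))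
    (v : mor Y Z) (w : mor Z (sh C X)) (c : mor W Z) :
  dist u p q ->
  (forall T (b : mor T Y), v ∘ b = 0 -> exists x, b = u ∘ x) ->
  (forall T (z : mor T Z), w ∘ z = 0 -> exists b, z = v ∘ b) ->
  fmap (sh C) u ∘ w = 0 -> c ∘ p = v -> w ∘ c = q -> dist u v w.
Proof.
move=> tri exY exZ uw0 cp wc; have c_iso := cone_map_iso tri exY exZ uw0 cp wc.
apply: (TR1_iso (iso_idm X) (iso_idm Y) c_iso _ _ _ tri).
- by rewrite comp1m compm1.
- by rewrite compm1.
- by rewrite fmap1 comp1m.
Qed.

Lemma tri_map_iso X Y Z Z' (u : mor X Y) (v : mor Y Z) (w : mor Z (sh C X))
    (v' : mor Y Z') (w' : mor Z' (sh C X)) (c : mor Z Z') :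
  dist u v w -> dist u v' w' -> c ∘ v = v' -> w' ∘ c = w -> is_iso c.
Proof.
move=> tri tri'; apply: (cone_map_iso tri) => [T b||].
- exact: (dist_lift tri').
- by move=> T z; exact: (dist_lift (dist_rot tri')).
- exact: dist_comp0_sh tri'.
Qed.

Lemma cocone_exists Y Z (v : mor Y Z) :
  exists (X : C) (u : mor X Y) (w : mor Z (sh C X)), dist u v w.
Proof.
have [W [g [h tri]]] := TR1_cone v.
have [X [i [j [ji ij]]]] := aeq_esurj (sh C) W.
have [u def_u] := aeq_full (h ∘ i).
exists X, (- u), (j ∘ g); apply/TR2.
have j_iso : is_iso j by exists i.
apply: (TR1_iso (iso_idm Y) (iso_idm Z) j_iso _ _ _ tri).
- by rewrite comp1m compm1.
- by rewrite compm1.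
- by rewrite linearN opprK -def_u fmap1 comp1m -compA ij compm1.
Qed.

(** If X is filtered by A, B and X'', then the two lowest layers can be
    grouped into an object E. The connecting map of E is the composite w1 ∘ u2,
    whose vanishing decides whether E is the direct sum of A and B. *)
Lemma octahedron_regroup A B X X' X''
    (u1 : mor A X) (v1 : mor X X') (w1 : mor X' (sh C A))
    (u2 : mor B X') (v2 : mor X' X'') (w2 : mor X'' (sh C B)) :
  dist u1 v1 w1 -> dist u2 v2 w2 ->
  exists (E : C) (e : mor E X) (r : mor X'' (sh C E))
    (s : mor A E) (t : mor E B) (z : mor B (sh C A)),
    [/\ dist s t z, dist e (v2 ∘ v1) r & z = w1 ∘ u2].
Proof.
move=> /dist_rot tri1 /dist_rot tri2.
have [E [e [r tri]]] := cocone_exists (v2 ∘ v1).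
have [s' [t' [triE _ _ _ _]]] := TR4 tri1 tri2 (dist_rot tri).
have [s def_s] := aeq_full s'; have [t def_t] := aeq_full t'.
exists E, e, r, s, t, (w1 ∘ u2); split=> //; apply/dist_shE.
by rewrite -def_s -def_t fmapM -compmN.
Qed.

Lemma split_triangle A B E (u : mor A E) (v : mor E B) :
  dist u v 0 -> exists (r : mor E A) (s : mor B E),
    [/\ r ∘ u = idm A, v ∘ s = idm B, r ∘ s = 0 & u ∘ r + s ∘ v = idm E].
Proof.
move=> tri.
have [|s vs] := dist_lift (b := idm B) (dist_rot tri); first by rewrite comp0m.
have u_inj T (x : mor T A) : u ∘ x = 0 -> x = 0.
  move=> ux0; have [|y] := dist_sh_lift (x := fmap (sh C) x) tri.
    by rewrite -fmapM ux0 linear0.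
  by rewrite comp0m -(linear0 (@fmap _ _ _ (sh C) T A)) => /aeq_faithful.
have [|r ur] := dist_lift (b := idm E - s ∘ v) tri.
  by rewrite compmB compm1 compA -vs comp1m subrr.
exists r, s; split=> //.
- apply/eqP; rewrite -subr_eq0; apply/eqP/u_inj.
  rewrite compmB compA -ur compBm comp1m compm1 -compA (dist_comp0 tri) compm0.
  by rewrite subr0 subrr.
- by apply: u_inj; rewrite compA -ur compBm comp1m -compA -vs compm1 subrr.
- by rewrite -ur subrK.
Qed.

(** The two layers of a split extension can be taken in either order. *)
Lemma split_triangle_swap A B E (u : mor A E) (v : mor E B) :
  dist u v 0 -> exists (s : mor B E) (r : mor E A), dist s r 0.
Proof.
move=> tri; have [r [s [ru vs rs sumE]]] := split_triangle tri.
exists s, r; have [W [p [q triW]]] := TR1_cone s.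
have [c rcp] := dist_colift triW rs.
have q0 : q = 0.
  have := dist_comp0_sh triW; move/(congr1 (mcomp (fmap (sh C) v))).
  by rewrite compA -fmapM vs fmap1 comp1m compm0.
apply: (dist_of_exact (c := c) triW) => [T b rb0|T z _|||] //.
- by exists (v ∘ b); rewrite -[LHS]comp1m -sumE compDm -!compA rb0 compm0 add0r.
- by exists (u ∘ z); rewrite compA ru comp1m.
- by rewrite compm0.
- by rewrite comp0m q0.
Qed.

Lemma dsum_of_split (A : bool -> C) E (u : mor (A true) E)
    (v : mor E (A false)) :
  dist u v 0 -> is_dsum A E.
Proof.
move=> tri; have [r [s [ru vs rs sumE]]] := split_triangle tri.
exists (fun b => if b as b return mor (A b) E then u else s),
       (fun b => if b as b return mor E (A b) then r else v); split.
- by case.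
- by case; case=> // _; exact: dist_comp0 tri.
- by rewrite big_bool.
Qed.

Lemma retract_summand X S : retract X S -> is_summand X S.
Proof.
move=> [i [r ri]]; have [W [p [q tri]]] := TR1_cone i.
have q0 : q = 0.
  have := dist_comp0_sh tri; move/(congr1 (mcomp (fmap (sh C) r))).
  by rewrite compA -fmapM ri fmap1 comp1m compm0.
exists W.
by apply: (@dsum_of_split (fun b => if b then X else W) _ i p); rewrite -q0.
Qed.

(** A retraction of the first two terms extends to the cones only up to an
    automorphism of X, which is then absorbed in the retraction. This replaces
    the addition of complementary summands to a triangle. *)
Lemma retract_cone X0 X1 X T0 T1 (f : mor X1 X0) (g : mor X0 X)
    (h : mor X (sh C X1)) :
  dist f g h -> retract X0 T0 -> retract X1 T1 ->
  exists (T : C) (f' : mor T1 T0) (g' : mor T0 T) (h' : mor T (sh C T1)),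
    dist f' g' h' /\ retract X T.
Proof.
move=> tri [i0 [r0 ri0]] [i1 [r1 ri1]].
have [T [g' [h' tri']]] := TR1_cone (i0 ∘ f ∘ r1).
exists T, (i0 ∘ f ∘ r1), g', h'; split=> //.
have [|i [ig hi]] := TR3 (a := i1) (b := i0) tri tri'.
  by rewrite -!compA ri1 compm1.
have [|r [rg hr]] := TR3 (a := r1) (b := r0) tri' tri.
  by rewrite !compA ri0 comp1m.
have [||j [ji _]] := tri_map_iso (c := r ∘ i) tri tri.
- by rewrite -compA ig compA rg -compA ri0 compm1.
- by rewrite compA -hr -compA -hi compA -fmapM ri1 fmap1 comp1m.
- by exists i, (j ∘ r); rewrite -compA.
Qed.

(** The componentwise maps w_i define a candidate third map, and exactness of
    the candidate is checked componentwise; the comparison from the actual cone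
    is assembled from maps to each of the given triangles. *)
Lemma dsum_triangle (I : finType) (X Y Z : I -> C) SX SY SZ
    (u : forall i, mor (X i) (Y i)) (v : forall i, mor (Y i) (Z i))
    (w : forall i, mor (Z i) (sh C (X i))) :
  is_dsum X SX -> is_dsum Y SY -> is_dsum Z SZ ->
  (forall i, dist (u i) (v i) (w i)) ->
  exists (u' : mor SX SY) (v' : mor SY SZ) (w' : mor SZ (sh C SX)),
    dist u' v' w'.
Proof.
move=> [jX [pX [pjX p0X sX]]] [jY [pY [pjY p0Y sY]]] [jZ [pZ [pjZ p0Z sZ]]] tri.
pose u' := \sum_i jY i ∘ u i ∘ pX i; pose v' := \sum_i jZ i ∘ v i ∘ pY i.
pose w' := \sum_i fmap (sh C) (jX i) ∘ w i ∘ pZ i.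
have kron (A B : I -> C) S S' (j : forall i, mor (A i) S)
    (p : forall i, mor S (A i)) (f : forall i, mor (B i) (A i))
    (q : forall i, mor S' (B i)) l :
    (forall i, p i ∘ j i = idm (A i)) ->
    (forall i i', i != i' -> p i' ∘ j i = 0) ->
    p l ∘ (\sum_i j i ∘ f i ∘ q i) = f l ∘ q l.
  move=> pj p0; rewrite comp_msum (bigD1 l) //= big1 ?addr0.
    by rewrite !compA pj comp1m.
  by move=> i ne; rewrite !compA p0 ?comp0m.
have pu l : pY l ∘ u' = u l ∘ pX l by exact: kron.
have pv l : pZ l ∘ v' = v l ∘ pY l by exact: kron.
have pw l : fmap (sh C) (pX l) ∘ w' = w l ∘ pZ l.
  rewrite /w'; apply: (kron (fun i => sh C (X i)) _ _ _
    (fun i => fmap (sh C) (jX i)) (fun i => fmap (sh C) (pX i))) => [i|i i' ne].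
  - by rewrite -fmapM pjX fmap1.
  - by rewrite -fmapM p0X // linear0.
exists u', v', w'; have [W [p [q triW]]] := TR1_cone u'.
have ex_c i : exists c : mor W (Z i),
    c ∘ p = v i ∘ pY i /\ fmap (sh C) (pX i) ∘ q = w i ∘ c.
  by apply: (TR3 triW (tri i)); rewrite pu.
have [c /all_and2[cp wc]] := fin_all_exists ex_c.
apply: (dist_of_exact (c := \sum_i jZ i ∘ c i) triW) => [T b vb0|T z wz0|||].
- have ex_x i : exists x, pY i ∘ b = u i ∘ x.
    by apply: (dist_lift (tri i)); rewrite compA -pv -compA vb0 compm0.
  have [x def_x] := fin_all_exists ex_x.
  exists (\sum_i jX i ∘ x i).
  rewrite -[LHS]comp1m -sY comp_summ /u' comp_summ; apply: eq_bigr => i _.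
  rewrite -!compA def_x; congr (_ ∘ (_ ∘ _)).
  rewrite comp_msum (bigD1 i) //= big1 ?addr0; first by rewrite compA pjX comp1m.
  by move=> l ne; rewrite compA p0X ?comp0m.
- have ex_b i : exists b, pZ i ∘ z = v i ∘ b.
    by apply: (dist_lift (dist_rot (tri i))); rewrite compA -pw -compA wz0 compm0.
  have [b def_b] := fin_all_exists ex_b.
  exists (\sum_i jY i ∘ b i).
  rewrite -[LHS]comp1m -sZ comp_summ /v' comp_summ; apply: eq_bigr => i _.
  rewrite -!compA def_b; congr (_ ∘ (_ ∘ _)).
  rewrite comp_msum (bigD1 i) //= big1 ?addr0; first by rewrite compA pjY comp1m.
  by move=> l ne; rewrite compA p0Y ?comp0m.
- rewrite -[LHS]comp1m -[idm _]fmap1 -sY linear_sum comp_summ big1 // => i _.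
  rewrite fmapM -compA [_ ∘ (_ ∘ w')]compA -fmapM pu fmapM -compA pw.
  by rewrite [fmap (sh C) (u i) ∘ _]compA (dist_comp0_sh (tri i)) comp0m compm0.
- by rewrite comp_summ; apply: eq_bigr => i _; rewrite -compA cp compA.
- rewrite -[RHS]comp1m -[idm _]fmap1 -sX (linear_sum (fmap (sh C))) [RHS]comp_summ.
  rewrite /w' [LHS]comp_summ; apply: eq_bigr => i _.
  rewrite fmapM -[RHS]compA wc -!compA.
  congr (_ ∘ (_ ∘ _)).
  rewrite comp_msum (bigD1 i) //= big1 ?addr0; first by rewrite compA pjZ comp1m.
  by move=> l ne; rewrite compA p0Z ?comp0m.
Qed.

End Triangles.

(** * Objects filtered by shifts of a class *)
Section Shifts.
Variables (k : fieldType) (C : triCat k).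
Implicit Types X Y Z A B T S E : C.

Lemma shiftD (m n : nat) X : shift C (m + n)%N X = shift C m (shift C n X).
Proof.
by elim: m => // m IHm; rewrite -[LHS]/(sh C (shift C (m + n)%N X)) IHm.
Qed.

Lemma shift_sh (n : nat) X : shift C n (sh C X) = sh C (shift C n X).
Proof. by rewrite -[sh C X]/(shift C 1 X) -shiftD addn1. Qed.

Lemma hom0_shift (n i : nat) X Y :
  hom0 X (shift C i Y) -> hom0 (shift C n X) (shift C (n + i)%N Y).
Proof. by rewrite shiftD hom0_aeq. Qed.

(** Weaker than being a triangle functor: nothing is said about the third map.
    This suffices to transport coresolutions, and it spares the construction of
    a natural isomorphism between E and its conjugate by the shift. *)
Definition preserves_cones (E : autoEquiv C) : Prop :=
  forall X Y Z (u : mor X Y) (v : mor Y Z) (w : mor Z (sh C X)),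
    dist u v w -> exists w', dist (fmap E u) (fmap E v) w'.

Lemma shift_cones (n : nat) : preserves_cones (shift C n).
Proof.
move=> X Y Z u v w tri; elim: n => [|n [w' IHn]]; first by exists w.
exact: dist_sh_ex IHn.
Qed.

Lemma iso_of_zero_fiber A X B (u : mor A X) (v : mor X B) (w : mor B (sh C A)) :
  dist u v w -> idm A = 0 -> is_iso v.
Proof.
move=> tri A0.
have [|b vb] := dist_lift (b := idm B) (dist_rot tri).
  by rewrite compm1 -[w]comp1m -fmap1 A0 linear0 comp0m.
have [|c e] := dist_lift (b := b ∘ v - idm X) tri.
  by rewrite compmB compA -vb comp1m compm1 subrr.
exists b; split=> //; apply/eqP; rewrite -subr_eq0 e.
by rewrite -[u]compm1 A0 compm0 comp0m.
Qed.

Lemma dist_hom0r A X B (u : mor A X) (v : mor X B) (w : mor B (sh C A)) T :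
  dist u v w -> hom0 T A -> hom0 T B -> hom0 T X.
Proof.
move=> tri TA TB f; have [c ->] := dist_lift tri (TB (v ∘ f)).
by rewrite (TA c) compm0.
Qed.

(** For l = [:: a1; ...; an] this is the class F[a1] * ... * F[an]. *)
Fixpoint filtered (F : C -> Prop) (l : seq nat) X : Prop :=
  if l is a :: l' then
    exists (Y X' : C) (u : mor (shift C a Y) X) (v : mor X X')
      (w : mor X' (sh C (shift C a Y))),
      [/\ F Y, dist u v w & filtered F l' X']
  else idm X = 0.

Lemma filtered1 (F : C -> Prop) (a : nat) Y :
  F Y -> filtered F [:: a] (shift C a Y).
Proof.
move=> FY; have [O O0] := zero_object C.
by exists Y, O, (idm _), 0, 0; split=> //; exact: TR1_id.
Qed.

Lemma filtered_iso F l X X' (f : mor X X') :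
  is_iso f -> filtered F l X -> filtered F l X'.
Proof.
move=> [g [gf fg]]; case: l => [|a l] /=.
  by move=> X0; rewrite -fg -[f]compm1 X0 compm0 comp0m.
move=> [Y [T [u [v [w [FY tri FT]]]]]]; exists Y, T, (f ∘ u), (v ∘ g), w.
split=> //; have f_iso : is_iso f by exists g.
apply: (TR1_iso (iso_idm _) f_iso (iso_idm _) _ _ _ tri).
- by rewrite compm1.
- by rewrite -compA gf compm1 comp1m.
- by rewrite fmap1 comp1m compm1.
Qed.

Lemma filtered_cat F l1 l2 A X B (u : mor A X) (v : mor X B) (w : mor B (sh C A)) :
  dist u v w -> filtered F l1 A -> filtered F l2 B -> filtered F (l1 ++ l2) X.
Proof.
elim: l1 A X u v w => [|a l1 IH] A X u v w tri /=.
  move=> A0; have [g [gv vg]] := iso_of_zero_fiber tri A0.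
  by apply: (@filtered_iso _ _ _ _ g); exists v.
move=> [Y [A' [f [g [h [FY triA FA']]]]]] FB.
have [X' [r [r' triX]]] := TR1_cone (u ∘ f).
have [p [q [tri' _ _ _ _]]] := TR4 triA tri triX.
by exists Y, X', (u ∘ f), r, r'; split=> //; exact: IH tri' FA' FB.
Qed.

Lemma filtered_shift F l (n : nat) X :
  filtered F l X -> filtered F (map (addn n) l) (shift C n X).
Proof.
elim: l X => [|a l IH] X /=; first by move=> X0; rewrite -fmap1 X0 linear0.
move=> [Y [X' [u [v [w [FY tri FX']]]]]].
have [w' tri'] := shift_cones n tri.
move: (fmap (shift C n) u) w' tri'; rewrite -shiftD => u' w' tri'.
by exists Y, (shift C n X'), u', (fmap (shift C n) v), w'; split=> //; exact: IH.
Qed.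

Lemma filtered_hom0 F (l : seq nat) T X :
  (forall a Y, a \in l -> F Y -> hom0 T (shift C a Y)) ->
  filtered F l X -> hom0 T X.
Proof.
elim: l X => [|a l IH] X homF /=.
  by move=> X0 f; rewrite -[f]comp1m X0 comp0m.
move=> [Y [X' [u [v [w [FY tri FX']]]]]]; apply: (dist_hom0r tri).
  by apply: homF FY; rewrite mem_head.
by apply: IH FX' => b Y' lb; apply: homF; rewrite in_cons lb orbT.
Qed.

(** If the objects of U are filtered by m consecutive shifts of F, each layer of
    a filtration by shifts of U is replaced by a block of m layers. *)
Lemma filtered_refine (U F : C -> Prop) (n m : nat) l X :
  (forall Y, U Y -> filtered F (iota 0 m) (shift C n Y)) ->
  filtered U l X -> filtered F (flatten [seq iota i m | i <- l]) (shift C n X).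
Proof.
move=> UF; elim: l X => [|a l IH] X /=.
  by move=> X0; rewrite -fmap1 X0 linear0.
move=> [Y [X' [u [v [w [UY tri FX']]]]]].
have [w' tri'] := shift_cones n tri.
apply: (filtered_cat tri'); last exact: IH.
rewrite -shiftD addnC shiftD -[a in iota a]addn0 iotaDl.
by apply: filtered_shift; exact: UF.
Qed.

Section Rigid.
Variables (F : C -> Prop) (d : nat).
Hypothesis F_dsum : forall n (A : 'I_n -> C) S,
  is_dsum A S -> (forall i, F (A i)) -> F S.
Hypothesis F_hom : forall (i : nat) X Y, F X -> F Y -> (1 <= i <= d.-1)%N ->
  hom0 X (shift C i Y).

Lemma rigid_hom0_shift (a b : nat) X Y :
  F X -> F Y -> (b <= a)%N -> (a < b + d.-1)%N ->
  hom0 (shift C b X) (sh C (shift C a Y)).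
Proof.
move=> FX FY ba ab; rewrite -[sh C _]/(shift C a.+1 Y).
have -> : a.+1 = (b + (a.+1 - b))%N by lia.
by apply: hom0_shift; apply: F_hom => //; lia.
Qed.

(** The extension of F[b] by F[a] is classified by Hom(F[b], F[a + 1]), which
    is zero by rigidity since 1 <= a - b + 1 <= d - 1; so it splits. *)
Lemma filtered_swap (a b : nat) l X : (b <= a)%N -> (a < b + d.-1)%N ->
  filtered F (a :: b :: l) X -> filtered F (b :: a :: l) X.
Proof.
move=> ba ab [Y1 [X' [u1 [v1 [w1 [FY1 tri1]]]]]].
move=> [Y2 [X'' [u2 [v2 [w2 [FY2 tri2 FX'']]]]]].
have [E [e [r [s [t [z [triE triX def_z]]]]]]] := octahedron_regroup tri1 tri2.
have z0 : z = 0 by apply: (rigid_hom0_shift FY2 FY1 ba ab).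
rewrite z0 in triE; have [s' [t' triE']] := split_triangle_swap triE.
apply: (filtered_cat (l1 := [:: b; a]) triX _ FX'').
by exists Y2, (shift C a Y1), s', t', 0; split=> //; exact: filtered1.
Qed.

Lemma filtered_merge (a : nat) l X : (0 < d.-1)%N ->
  filtered F (a :: a :: l) X -> filtered F (a :: l) X.
Proof.
move=> d1 [Y1 [X' [u1 [v1 [w1 [FY1 tri1]]]]]].
move=> [Y2 [X'' [u2 [v2 [w2 [FY2 tri2 FX'']]]]]].
have [E [e [r [s [t [z [triE triX def_z]]]]]]] := octahedron_regroup tri1 tri2.
have z0 : z = 0 by apply: (rigid_hom0_shift FY2 FY1) => //; lia.
rewrite z0 in triE; apply: (filtered_cat (l1 := [:: a]) triX _ FX'').
pose A b := shift C a (if b then Y1 else Y2).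
have dE := @dsum_of_split _ _ A _ s t triE.
have [E' [i i_iso]] := aeq_esurj (shift C a) E.
apply: (filtered_iso i_iso); apply: filtered1.
have [j [ji ij]] := i_iso.
have dE' : is_dsum (fun b : bool => if b then Y1 else Y2) E'.
  apply: (@dsum_aeq _ _ (shift C a)); apply: (dsum_iso (f := j) _ dE).
  by exists i; split.
by apply: (F_dsum (dsum_enum dE')) => l0; case: (enum_val l0).
Qed.

(** Insertion sort, one new layer at a time: a layer a is exchanged with the
    smaller ones and merged with an equal one. *)
Lemma filtered_insert (a : nat) (l : seq nat) X :
  sorted ltn l -> (forall b, b \in l -> (a < b + d.-1)%N) ->
  filtered F (a :: l) X ->
  exists l', [/\ sorted ltn l', {subset l' <= a :: l} & filtered F l' X].
Proof.
elim: l X => [|b l IH] X; first by move=> _ _ FX; exists [:: a]; split.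
move=> bl al; have ab : (a < b + d.-1)%N by apply: al; rewrite mem_head.
case: (ltngtP a b) => [lt_ab|lt_ba|eq_ab] FX.
- exists [:: a, b & l]; split=> //; exact/andP.
- have /= [Y [X' [u [v [w [FY tri FX']]]]]] := filtered_swap (ltnW lt_ba) ab FX.
  have [||l' [sl' sub FX'']] := IH X' _ _ FX'.
  + exact: path_sorted bl.
  + by move=> c lc; apply: al; rewrite in_cons lc orbT.
  exists (b :: l'); split; last by exists Y, X', u, v, w.
  + rewrite /= path_min_sorted //; apply/allP => c /sub.
    rewrite in_cons => /predU1P[-> //|]; apply/allP: c.
    by apply: order_path_min bl; exact: ltn_trans.
  + move=> c; rewrite !in_cons => /predU1P[-> |/sub]; first by rewrite eqxx orbT.
    by rewrite in_cons => /orP[] ->; rewrite ?orbT.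
- exists (b :: l); split=> //; first by move=> c lc; rewrite in_cons lc orbT.
  by apply: filtered_merge; [lia | rewrite eq_ab in FX].
Qed.

Lemma filtered_sort (l : seq nat) X :
  pairwise (fun a b => a < b + d.-1)%N l -> filtered F l X ->
  exists l', [/\ sorted ltn l', {subset l' <= l} & filtered F l' X].
Proof.
elim: l X => [|a l IH] X; first by exists [::].
move=> /= /andP[/allP al pl] [Y [X' [u [v [w [FY tri FX']]]]]].
have [l' [sl' sub FX'']] := IH X' pl FX'.
have [||l'' [sl'' sub' FX]] := @filtered_insert a l' X sl'.
- by move=> b /sub; exact: al.
- by exists Y, X', u, v, w.
exists l''; split=> // c /sub'; rewrite !in_cons => /orP[-> //|/sub ->].
by rewrite orbT.
Qed.

(** Only the layer of degree d - 1 of T interacts with X[d - 1]: layers of lower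
    degree have no maps to it and layers of higher degree receive none from it.
    As the degrees are strictly increasing there is at most one such layer. *)
Lemma filtered_factor (X : C) :
  (forall (i : nat) Y, F Y -> (1 <= i <= d.-1)%N ->
     hom0 X (shift C i Y) /\ hom0 Y (shift C i X)) ->
  forall (l : seq nat) T (f : mor (shift C d.-1 X) T) (g : mor T (shift C d.-1 X)),
    sorted ltn l -> (forall a, a \in l -> (a <= d.-1 + d.-1)%N) -> filtered F l T ->
    exists Y, F Y /\ exists (p : mor (shift C d.-1 X) (shift C d.-1 Y))
      (q : mor (shift C d.-1 Y) (shift C d.-1 X)), g ∘ f = q ∘ p.
Proof.
move=> homX; have [O O0] := zero_object C.
have FO : F O.
  apply: (@F_dsum _ (empty_family C)) => [|[]//].
  exists (fun i => 0), (fun i => 0); split; [by case | by case|].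
  by rewrite big_ord0 O0.
elim=> [|a l IH] T f g sl ll FT.
  by exists O; split=> //; exists 0, 0; rewrite -[f]comp1m FT !comp0m compm0.
have lt_al : {in l, forall b, (a < b)%N}.
  by apply/allP; apply: order_path_min sl; exact: ltn_trans.
have homXs b Y : (d.-1 < b <= d.-1 + d.-1)%N -> F Y ->
    hom0 (shift C d.-1 X) (shift C b Y).
  move=> ltb FY; have -> : b = (d.-1 + (b - d.-1))%N by lia.
  by apply: hom0_shift; have [|//] := homX (b - d.-1)%N _ FY _; lia.
case: (ltngtP a d.-1) => [lt_ad|lt_da|eq_ad].
- case: FT => Y [T' [u [v [w [FY tri FT']]]]].
  have [|g' def_g] := dist_colift (f := g) tri.
    suff h : hom0 (shift C a Y) (shift C d.-1 X) by exact: h.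
    have -> : d.-1 = (a + (d.-1 - a))%N by lia.
    by apply: hom0_shift; have [|//] := homX (d.-1 - a)%N _ FY _; lia.
  rewrite def_g -compA; apply: IH FT' => [|b lb]; first exact: path_sorted sl.
  by apply: ll; rewrite in_cons lb orbT.
- have f0 : f = 0.
    apply: (filtered_hom0 _ FT) => b Y lb; apply: homXs; rewrite ll // andbT.
    by move: lb; rewrite in_cons => /predU1P[-> //|/lt_al]; apply: ltn_trans.
  by exists O; split=> //; exists 0, 0; rewrite f0 !compm0.
- case: FT => Y; rewrite eq_ad => -[T' [u [v [w [FY tri FT']]]]].
  have [|f' def_f] := dist_lift (b := f) tri.
    suff h : hom0 (shift C d.-1 X) T' by exact: h.
    apply: (filtered_hom0 _ FT') => b Y' lb; apply: homXs.
    by rewrite ll ?in_cons ?lb ?orbT // andbT -eq_ad; exact: lt_al.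
  by exists Y; split=> //; exists f', (g ∘ u); rewrite def_f compA.
Qed.

End Rigid.
End Shifts.

(** * Additive closures and finite coresolutions *)
Section Additive.
Variables (k : fieldType) (C : triCat k).
Implicit Types (X Y S : C) (P Q : C -> Prop).

Lemma add_closure_retract P X Y :
  retract X Y -> add_closure P Y -> add_closure P X.
Proof.
move=> XY [n [A [S [PA dS /summand_retract YS]]]].
by exists n, A, S; split=> //; apply/retract_summand/(retract_trans XY).
Qed.

Lemma add_closure_dsum P n (X : 'I_n -> C) S :
  is_dsum X S -> (forall i, add_closure P (X i)) -> add_closure P S.
Proof.
move=> dS /fin_all_exists[m] /fin_all_exists[A] /fin_all_exists[T PT].
have [T' dT'] := tri_additive T.
have dT i : is_dsum (A i) (T i) by have [] := PT i.
have dT'' := dsum_enum (dsum_comp (J := fun i => 'I_(m i) : finType) dT' dT).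
eexists _, _, T'; split; last 2 first; first exact: dT''.
- apply: retract_summand; have [inj [proj [pi p0 sumE]]] := dS.
  have [j [q [qj q0 sumT]]] := dT'.
  have rT i : retract (X i) (T i) by have [_ _ /summand_retract] := PT i.
  have [a /fin_all_exists[b ba]] := fin_all_exists rT.
  exists (\sum_i j i ∘ a i ∘ proj i), (\sum_i inj i ∘ b i ∘ q i).
  rewrite comp_summ -sumE; apply: eq_bigr => i _.
  rewrite comp_msum (bigD1 i) //= big1 ?addr0 => [|l ne].
    rewrite !compA -(compA (inj i ∘ b i)) qj compm1 -(compA (inj i)) ba.
    by rewrite compm1.
  by rewrite !compA -(compA (inj i ∘ b i)) q0 // compm0 !comp0m.
- by move=> l; have [+ _ _] := PT (tag (enum_val l)); exact.
Qed.

Lemma dsum_single X : is_dsum (fun _ : 'I_1 => X) X.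
Proof.
exists (fun _ => idm X), (fun _ => idm X); split.
- by move=> _; rewrite comp1m.
- by move=> i j; rewrite !ord1.
- by rewrite big_ord1 comp1m.
Qed.

Lemma add_closure_incl P X : P X -> add_closure P X.
Proof.
move=> PX; exists 1%N, (fun _ => X), X; split=> //; first exact: dsum_single.
exact/retract_summand/retract_refl.
Qed.

(** A coresolution Y -> V^0 -> ... -> V^m with terms in P, where m successive
    triangles take the place of an exact sequence; V^m is the last cone. *)
Fixpoint coresolvable P m Y : Prop :=
  if m is m'.+1 then
    exists (V0 Y1 : C) (u : mor Y V0) (v : mor V0 Y1) (w : mor Y1 (sh C Y)),
      [/\ P V0, dist u v w & coresolvable P m' Y1]
  else P Y.

Lemma coresolvable_map (E : autoEquiv C) P Q m Y :
  preserves_cones E -> (forall X, P X -> Q (E X)) ->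
  coresolvable P m Y -> coresolvable Q m (E Y).
Proof.
move=> Econes PQ; elim: m Y => [|m IH] Y /=; first exact: PQ.
move=> [V0 [Y1 [u [v [w [PV0 tri cY1]]]]]].
have [w' tri'] := Econes _ _ _ _ _ _ tri.
exists (E V0), (E Y1), (fmap E u), (fmap E v), w'.
by split; [exact: PQ | | exact: IH].
Qed.

Lemma coresolvable_sub P Q m Y :
  (forall X, P X -> Q X) -> coresolvable P m Y -> coresolvable Q m Y.
Proof.
by move=> PQ; apply: (@coresolvable_map (aeq_id C)) => // ? ? ? u v w; exists w.
Qed.

Lemma coresolvable_dsum P m n (Y : 'I_n -> C) S :
  (forall n (A : 'I_n -> C) S, is_dsum A S -> (forall i, P (A i)) -> P S) ->
  is_dsum Y S -> (forall i, coresolvable P m (Y i)) -> coresolvable P m S.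
Proof.
move=> Psum; elim: m Y S => [|m IH] Y S dS /=; first exact: Psum dS.
move=> /fin_all_exists[V0] /fin_all_exists[Y1] /fin_all_exists[u].
move=> /fin_all_exists[v] /fin_all_exists[w triP].
have [T0 dT0] := tri_additive V0; have [T1 dT1] := tri_additive Y1.
have [|u' [v' [w' tri]]] := dsum_triangle (u := u) (v := v) (w := w) dS dT0 dT1.
  by move=> i; have [] := triP i.
exists T0, T1, u', v', w'; split=> //.
- by apply: (Psum _ _ _ dT0) => i; have [] := triP i.
- by apply: (IH _ _ dT1) => i; have [] := triP i.
Qed.

(** Rotating Y -> V0 -> Y1 -> Y[1] exhibits Y[1] as an extension of V0[1] by
    Y1, so the terms of the coresolution appear in reverse order. *)
Lemma coresolvable_filtered P m Y :
  coresolvable P m Y -> filtered P (iota 0 m.+1) (shift C m Y).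
Proof.
elim: m Y => [|m IH] Y; first exact: (@filtered1 _ _ _ 0).
move=> [V0 [Y1 [u [v [w [PV0 tri cY1]]]]]].
have [w' tri'] := shift_cones m (dist_rot (dist_rot tri)).
have -> : iota 0 m.+2 = iota 0 m.+1 ++ iota m.+1 1 by rewrite -iotaD addn1.
suff: filtered P (iota 0 m.+1 ++ iota m.+1 1) (sh C (shift C m Y)) by [].
rewrite -shift_sh.
apply: (filtered_cat tri' (IH _ cY1)); rewrite shift_sh.
exact: (@filtered1 _ _ _ m.+1).
Qed.

End Additive.

(** * Cluster tilting subcategories and their generators *)
Section ClusterTilting.
Variables (k : fieldType) (C : triCat k) (d : nat).
Implicit Types (X Y Z S T : C) (U V : C -> Prop).

Lemma ct_hom0 V X Y (i : nat) : cluster_tilting d V -> V X -> V Y ->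
  (1 <= i <= d.-1)%N -> hom0 X (shift C i Y).
Proof. by move=> [_ VE _] VX /VE VY di f; exact: VY di _ VX f. Qed.

Lemma ct_dsum V n (A : 'I_n -> C) S :
  cluster_tilting d V -> is_dsum A S -> (forall i, V (A i)) -> V S.
Proof.
move=> ctV dS VA; have [_ _ VE] := ctV; apply/VE => i di Y VY.
by apply: (dsum_hom0l dS) => j; exact: (ct_hom0 ctV _ _ di).
Qed.

Lemma ct_retract V X S : cluster_tilting d V -> retract X S -> V S -> V X.
Proof.
move=> ctV XS VS; have [_ _ VE] := ctV; apply/VE => i di Y VY.
by apply: (retract_hom0l XS); exact: (ct_hom0 ctV _ _ di).
Qed.

Lemma ct_add_closure V (G : C -> Prop) X : cluster_tilting d V ->
  (forall Y, G Y -> V Y) -> add_closure G X -> V X.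
Proof.
move=> ctV GV [n [A [S [GA dS /summand_retract XS]]]].
by apply: (ct_retract ctV XS); apply: (ct_dsum ctV dS) => i; exact: GV.
Qed.

Lemma ct_pair V X Y : cluster_tilting d V -> V X -> V Y ->
  exists S, [/\ V S, retract X S & retract Y S].
Proof.
move=> ctV VX VY.
have [S dS] := tri_additive (fun i : 'I_2 => if val i is 0%N then X else Y).
exists S; split.
- by apply: (ct_dsum ctV dS) => -[[|[]]].
- have [inj [proj [pi _ _]]] := dS.
  by exists (inj ord0), (proj ord0); exact: (pi ord0).
- have [inj [proj [pi _ _]]] := dS.
  by exists (inj ord_max), (proj ord_max); exact: (pi ord_max).
Qed.

(** Passing from Y to the cone of a left V-approximation gains one degree of
    vanishing of Hom(Y, V[i]): in degree 1 by the approximation property, in the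
    higher degrees by dimension shift. After d - 1 steps the cone is in V. All
    terms are retracts of one object W, the direct sum of the approximations. *)
Lemma ct_coresolution V m j Y : cluster_tilting d V -> (m + j = d.-1)%N ->
  (forall (i : nat) Z, (1 <= i <= j)%N -> V Z -> hom0 Y (shift C i Z)) ->
  exists W, V W /\ coresolvable (fun X => retract X W) m Y.
Proof.
move=> ctV; elim: m j Y => [|m IH] j Y mj homY.
  exists Y; split; last exact: retract_refl.
  have [_ _ VE] := ctV; apply/VE => i di Z VZ.
  by apply: homY; rewrite // -[j]add0n mj.
have [[_ covV] _ _] := ctV; have [V0 [u [VV0 u_approx]]] := covV Y.
have [Y1 [v [w tri]]] := TR1_cone u.
have [||W [VW cW]] := IH j.+1 Y1; first by rewrite -mj addnS.
  move=> [//|i] Z /= ij VZ f.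
  (* f vanishes on V0, hence factors through Y[1] by the shift of a map
     Y -> Z[i], which is 0 for i > 0 and extends to V0 for i = 0. *)
  have [|g def_f] := dist_sh_colift (f := f) tri.
    suff h : hom0 V0 (shift C i.+1 Z) by exact: h.
    by apply: (ct_hom0 ctV); rewrite //; lia.
  have [g' def_g] := @aeq_full _ _ (sh C) Y (shift C i Z) g.
  have [i0|i_gt0] := posnP i; last first.
    by rewrite def_f def_g (homY i Z _ VZ g') ?linear0 ?comp0m // i_gt0.
  move: Z i0 VZ g' f g def_f def_g {ij} => Z; case: i => // _ VZ g' f g -> ->.
  have [h ->] := u_approx Z g' VZ.
  by rewrite fmapM -compA (dist_comp0_sh tri) compm0.
have [S [VS V0S WS]] := ct_pair ctV VV0 VW.
exists S; split=> //; exists V0, Y1, u, v, w; split=> //.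
by apply: coresolvable_sub cW => X XW; exact: retract_trans XW WS.
Qed.

(** Dually, cocones of right U-approximations resolve X by objects of U. These
    are only retracts of objects of P (the finite sums of generators), and by
    [retract_cone] the whole resolution embeds as a retract in one by P. *)
Lemma ct_resolution U (P : C -> Prop) m j X : cluster_tilting d U ->
  (forall Y, U Y -> exists S, P S /\ retract Y S) -> (m + j = d.-1)%N ->
  (forall (i : nat) Z, (1 <= i <= j)%N -> U Z -> hom0 Z (shift C i X)) ->
  exists T, filtered P (iota 0 m.+1) T /\ retract X T.
Proof.
move=> ctU UP; elim: m j X => [|m IH] j X mj homX.
  have [_ UE _] := ctU; have [|S [PS XS]] := UP X.
    by apply/UE => i di Z UZ; apply: homX; rewrite // -[j]add0n mj.
  by exists S; split=> //; exact: (@filtered1 _ _ _ 0).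
have [[conU _] _ _] := ctU; have [U0 [g [UU0 g_approx]]] := conU X.
have [X1 [f [w tri]]] := cocone_exists g.
have [||T' [fT' X1T']] := IH j.+1 X1; first by rewrite -mj addnS.
  move=> [//|i] Z /= ij UZ h.
  have [w' tri'] := shift_cones i tri.
  have [|y ->] := dist_sh_lift (x := h) tri'.
    suff hU : hom0 Z (shift C i.+1 U0) by exact: hU.
    by apply: (ct_hom0 ctU); rewrite //; lia.
  have [i0|i_gt0] := posnP i; last first.
    by rewrite (homX i Z _ UZ y) ?compm0 // i_gt0.
  move: h w' tri' y {ij}; rewrite i0 => _ w' tri' y.
  have [y' ->] := g_approx Z y UZ.
  by rewrite compA (dist_comp0 (dist_rot tri')) comp0m.
have [S [PS U0S]] := UP U0 UU0.
have [T [f' [g' [h' [tri' XT]]]]] := retract_cone tri U0S X1T'.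
exists T; split=> //.
exists S, (sh C T'), g', h', (- fmap (sh C) f'); split=> //; first exact: dist_rot.
by have := filtered_shift 1 fT'; rewrite -iotaDl.
Qed.

(** With n = d - 1 this is the condition under which layers can be sorted. It
    holds since the blocks have n + 1 degrees and move up by one each time, so a
    degree exceeds a later one by at most n - 1. *)
Lemma pairwise_blocks n s t :
  pairwise (fun a b => a < b + n)%N (flatten [seq iota i n.+1 | i <- iota s t]).
Proof.
elim: t s => // t IH s; rewrite [iota s _]/= [flatten _]/= -cat_cons pairwise_cat.
rewrite {}IH andbT; apply/andP; split.
  apply/allrelP => a b; rewrite -[s :: _]/(iota s n.+1) mem_iota => a_s.
  move=> /flatten_mapP[i]; rewrite -[i :: _]/(iota i n.+1) !mem_iota; lia.
rewrite -[s :: _]/(iota s n.+1); have := iota_ltn_sorted s n.+1.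
rewrite (sorted_pairwise ltn_trans); apply: sub_pairwise => a b; exact: ltn_addr.
Qed.

(** If X is in V, it is a retract of an object T resolved by finite sums of
    objects of GU. Refining that filtration by the coresolutions and sorting the
    layers leaves one layer of degree d - 1, through which X[d - 1] factors. *)
Theorem cluster_tilting_generated U V (GU GV : C -> Prop) :
  (1 <= d)%N -> cluster_tilting d U -> cluster_tilting d V ->
  (forall X, U X -> add_closure GU X) -> (forall X, GV X -> V X) ->
  (forall g, GU g -> coresolvable (add_closure GV) d.-1 g) ->
  forall X, V X <-> add_closure GV X.
Proof.
move=> d1 ctU ctV UG GV_V cGU X; split; last exact: ct_add_closure.
move=> VX; set F := add_closure GV; have FV Y : F Y -> V Y by exact: ct_add_closure.
pose U0 S := exists n (A : 'I_n -> C), (forall i, GU (A i)) /\ is_dsum A S.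
have UU0 Y : U Y -> exists S, U0 S /\ retract Y S.
  move=> /UG[n [A [S [GA dS /summand_retract YS]]]].
  by exists S; split=> //; exists n, A.
have [||T [fT [i [r ri]]]] := @ct_resolution U U0 d.-1 0 X ctU UU0.
- by rewrite addn0.
- by move=> [].
have {fT}: filtered F (flatten [seq iota i d.-1.+1 | i <- iota 0 d.-1.+1])
    (shift C d.-1 T).
  apply: filtered_refine fT => S [n [A [GA dS]]]; apply/coresolvable_filtered.
  apply: (coresolvable_dsum _ dS) => [m B Y dY FB|j]; last exact: cGU.
  exact: add_closure_dsum dY FB.
have F_dsum n (A : 'I_n -> C) S : is_dsum A S -> (forall i, F (A i)) -> F S.
  exact: add_closure_dsum.
have F_hom (n : nat) Y Z : F Y -> F Z -> (1 <= n <= d.-1)%N -> hom0 Y (shift C n Z).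
  by move=> /FV VY /FV VZ; exact: ct_hom0 ctV VY VZ.
(* X is a retract of T, and T[d - 1] is filtered by d blocks of d layers. *)
move=> /(filtered_sort F_dsum F_hom (pairwise_blocks _ _ _))[l [sl sub fT]].
have homX (n : nat) Y : F Y -> (1 <= n <= d.-1)%N ->
    hom0 X (shift C n Y) /\ hom0 Y (shift C n X).
  by move=> /FV VY dn; split; exact: (ct_hom0 ctV _ _ dn).
have [|Y [FY [p [q e]]]] := @filtered_factor _ _ F d F_dsum X homX l _
    (fmap (shift C d.-1) i) (fmap (shift C d.-1) r) sl _ fT.
  by move=> a /sub/flatten_mapP[b]; rewrite !(mem_iota _ d.-1.+1); lia.
apply: add_closure_retract FY; apply: (@retract_aeq _ _ (shift C d.-1)).
by exists p, q; rewrite -e -fmapM ri fmap1.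
Qed.

End ClusterTilting.

(** * Linear functionals *)
Section Functionals.
Variables (k : fieldType).

Lemma functional_factor (P H : vectType k) (L : 'Hom(P, H)) (phi : 'Hom(P, k^o)) :
  (forall x, L x = 0 -> phi x = 0) ->
  exists psi : 'Hom(H, k^o), forall x, psi (L x) = phi x.
Proof.
move=> ker0; exists (phi \o L^-1)%VF => x; rewrite comp_lfunE.
apply/eqP; rewrite -subr_eq0 -linearB; apply/eqP/ker0.
by rewrite linearB /= limg_lfunVK ?subrr // memv_img ?memvf.
Qed.

Definition diff_pair (P Q H : vectType k) (A : 'Hom(P, H)) (B : 'Hom(Q, H))
  (x : P * Q) : H := A x.1 - B x.2.

Fact diff_pair_linear (P Q H : vectType k) (A : 'Hom(P, H)) (B : 'Hom(Q, H)) :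
  linear (diff_pair A B).
Proof.
move=> a [x1 x2] [y1 y2].
by rewrite /diff_pair /= !linearP /= scalerBr scalerN addrACA.
Qed.

HB.instance Definition _ (P Q H : vectType k) (A : 'Hom(P, H)) (B : 'Hom(Q, H)) :=
  GRing.isLinear.Build k (P * Q)%type H *:%R (diff_pair A B)
    (diff_pair_linear A B).

Lemma functional_glue (P Q H : vectType k) (A : 'Hom(P, H)) (B : 'Hom(Q, H))
    (alpha : 'Hom(P, k^o)) (beta : 'Hom(Q, k^o)) :
  (forall p q, A p = B q -> alpha p = beta q) ->
  exists psi : 'Hom(H, k^o),
    (forall p, psi (A p) = alpha p) /\ (forall q, psi (B q) = beta q).
Proof.
move=> compat.
have [|psi psiE] := @functional_factor _ _ (linfun (diff_pair A B))
  (linfun (diff_pair alpha beta)).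
  move=> [p q]; rewrite !lfunE /= /diff_pair /= => /eqP.
  by rewrite subr_eq0 => /eqP/compat ->; rewrite subrr.
exists psi; split=> [p|q].
  by have := psiE (p, 0); rewrite !lfunE /= /diff_pair /= !linear0 !addr0.
have := psiE (0, q); rewrite !lfunE /= /diff_pair /= !linear0 !sub0r linearN.
exact: oppr_inj.
Qed.

Lemma functional_separate (H : vectType k) (x : H) :
  (forall phi : 'Hom(H, k^o), phi x = 0) -> x = 0.
Proof.
move=> x0; rewrite (coord_vbasis (memvf x)) big1 // => i _.
have := x0 (linfun (coord (vbasis fullv) i : H -> k^o)).
by rewrite lfunE /= => ->; rewrite scale0r.
Qed.

End Functionals.

(** * The trace of a Serre functor *)
Section SerreTrace.
Variables (k : fieldType) (C : linCat k) (S : serreFunctor C).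
Implicit Types X Y : C.

(** The functional corresponding to the identity of S X. Serre duality is then
    the perfect pairing tau (f ∘ g) of Hom(Y, S X) with Hom(X, Y), and its
    naturality in X is the cyclicity [trace_cyclic]. *)
Definition is_trace X (tau : dual (mor X (S X))) : Prop :=
  serre_iso S X (S X) tau = idm (S X).

Lemma trace_exists X : exists tau, is_trace (X := X) tau.
Proof.
by have [g _ gK] := serre_bij S X (S X); exists (g (idm (S X))); exact: gK.
Qed.

Lemma trace_serre X Y (tau : dual (mor X (S X))) (f : mor Y (S X)) :
  is_trace tau -> serre_iso S X Y (tau \o linfun (mcomp f))%VF = f.
Proof. by move=> tauE; rewrite serre_natY tauE comp1m. Qed.

Lemma trace_repr X Y (tau : dual (mor X (S X))) (phi : 'Hom(mor X Y, k^o)) :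
  is_trace tau -> exists f : mor Y (S X), forall g, phi g = tau (f ∘ g).
Proof.
move=> tauE; exists (serre_iso S X Y phi) => g.
have := trace_serre (serre_iso S X Y phi) tauE.
by move/(bij_inj (serre_bij S X Y)) => {1}<-; rewrite comp_lfunE lfunE.
Qed.

Lemma trace_nondeg X Y (tau : dual (mor X (S X))) (f : mor Y (S X)) :
  is_trace tau -> (forall g, tau (f ∘ g) = 0) -> f = 0.
Proof.
move=> tauE f0; rewrite -(trace_serre f tauE) -[RHS](linear0 (serre_iso S X Y)).
congr (serre_iso S X Y _); apply/lfunP => g.
by rewrite comp_lfunE !lfunE /= f0.
Qed.

Lemma trace_eq X Y (tau : dual (mor X (S X))) (f f' : mor Y (S X)) :
  is_trace tau -> (forall g, tau (f ∘ g) = tau (f' ∘ g)) -> f = f'.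
Proof.
move=> tauE ff'; apply/eqP; rewrite -subr_eq0; apply/eqP.
by apply: (trace_nondeg tauE) => g; rewrite compBm linearB /= ff' subrr.
Qed.

Lemma trace_cyclic X X' (tau : dual (mor X (S X))) (tau' : dual (mor X' (S X')))
    (a : mor X X') (f : mor X' (S X)) :
  is_trace tau -> is_trace tau' -> tau' (fmap S a ∘ f) = tau (f ∘ a).
Proof.
move=> tauE tauE'.
have e1 := serre_natX S a (tau \o linfun (mcomp f))%VF.
rewrite (trace_serre f tauE) -(trace_serre (fmap S a ∘ f) tauE') in e1.
have /lfunP/(_ (idm X')) := bij_inj (serre_bij S X' X') e1.
by rewrite !comp_lfunE !lfunE /= /precomp comp1m compm1 => <-.
Qed.

Lemma serre_hom0 X Y : hom0 X Y <-> hom0 Y (S X).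
Proof.
split=> XY f.
  have [g _ gK] := serre_bij S X Y; rewrite -[f]gK.
  rewrite -[RHS](linear0 (serre_iso S X Y)); congr (serre_iso S X Y _).
  by apply/lfunP => x; rewrite (XY x) !linear0.
apply: functional_separate => phi.
have [tau tauE] := trace_exists X; have [h ->] := trace_repr phi tauE.
by rewrite (XY h) comp0m linear0.
Qed.

End SerreTrace.

(** * Equivalences and cones *)
Section ExactEquivalence.
Variables (k : fieldType) (C : triCat k).
Implicit Types (E : autoEquiv C) (X Y Z T W : C).

Lemma iso_reflect E X Y (f : mor X Y) : is_iso (fmap E f) -> is_iso f.
Proof.
move=> [g]; have [h ->] := aeq_full g; rewrite -!fmapM -!fmap1.
by move=> [/aeq_faithful hf /aeq_faithful fh]; exists h.
Qed.

Lemma aeq_dist_lift E X Y Z (u : mor X Y) (v : mor Y Z) (w : mor Z (sh C X)) T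
    (b : mor T (E Y)) :
  dist u v w -> fmap E v ∘ b = 0 -> exists c, b = fmap E u ∘ c.
Proof.
move=> tri vb0; have [T' [i [j [ji ij]]]] := aeq_esurj E T.
have [b' def_b'] := aeq_full (b ∘ i).
have [|c def_c] := dist_lift (b := b') tri.
  by apply: (@aeq_faithful _ _ E); rewrite fmapM -def_b' compA vb0 comp0m linear0.
exists (fmap E c ∘ j).
by rewrite compA -fmapM -def_c -def_b' -compA ij compm1.
Qed.

Lemma cones_comp E F :
  preserves_cones E -> preserves_cones F -> preserves_cones (aeq_comp E F).
Proof.
move=> Ec Fc X Y Z u v w /Fc[w' /Ec[w'' tri]].
by exists w''.
Qed.

Lemma cones_id : preserves_cones (aeq_id C).
Proof. by move=> X Y Z u v w; exists w. Qed.

(** If W is a cone of E'(u), then E(W) and Z are both cones of u, up to the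
    isomorphism of E E' with the identity. The resulting isomorphism from E(W)
    to E(E'(Z)) is the image under E of an isomorphism from W to E'(Z). *)
Lemma cones_inv E : preserves_cones E -> preserves_cones (aeq_inv E).
Proof.
move=> Ec X Y Z u v w tri /=; set E' := aeq_qinv E.
have [t [t' [tN t't tt']]] := aeq_counit E.
have [W [p [q triW]]] := TR1_cone (fmap E' u).
have [w1 triEW] := Ec _ _ _ _ _ _ triW.
have tX_iso : is_iso (t X) by exists (t' X); split; [exact: t't | exact: tt'].
have tY_iso : is_iso (t Y) by exists (t' Y); split; [exact: t't | exact: tt'].
have t'tY : t' Y ∘ t Y = idm (E (E' Y)) := t't Y.
have tt'Z : t Z ∘ t' Z = idm Z := tt' Z.
have t'tZ : t' Z ∘ t Z = idm (E (E' Z)) := t't Z.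
have t'tX : t' X ∘ t X = idm (E (E' X)) := t't X.
have tri2 : dist u (fmap E p ∘ t' Y) (fmap (sh C) (t X) ∘ w1).
  apply: (TR1_iso tX_iso tY_iso (iso_idm (E W)) _ _ _ triEW).
  - exact: tN.
  - by rewrite comp1m -compA t'tY compm1.
  - by rewrite compm1.
have [|c [cv wc]] := TR3 (a := idm X) (b := idm Y) tri2 tri.
  by rewrite comp1m compm1.
rewrite compm1 in cv; rewrite fmap1 comp1m in wc.
have [c' [c'c cc']] := tri_map_iso tri2 tri cv (esym wc).
have [c0 def_c0] := @aeq_full _ _ E W (E' Z) (t' Z ∘ c).
have c0_iso : is_iso c0.
  apply: (@iso_reflect E); rewrite -def_c0; exists (c' ∘ t Z); split.
    by rewrite -compA (compA (t Z)) tt'Z comp1m.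
  by rewrite -compA (compA c) cc' comp1m.
have c0p : c0 ∘ p = fmap E' v.
  apply: (@aeq_faithful _ _ E); rewrite fmapM -def_c0 -[RHS]comp1m -t'tZ.
  have /= tv := tN _ _ v.
  by rewrite -[RHS]compA tv -cv -!compA t'tY compm1.
have [c0' [c0'c0 c0c0']] := c0_iso.
exists (q ∘ c0').
apply: (TR1_iso (iso_idm _) (iso_idm _) c0_iso _ _ _ triW).
- by rewrite comp1m compm1.
- by rewrite compm1.
- by rewrite fmap1 comp1m -compA c0'c0 compm1.
Qed.

Lemma cones_pow E (i : int) : preserves_cones E -> preserves_cones (aeq_pow E i).
Proof.
move=> Ec; have iter_cones F n : preserves_cones F ->
    preserves_cones (iter n (aeq_comp F) (aeq_id C)).
  by move=> Fc; elim: n => [|n IH]; [exact: cones_id | exact: cones_comp].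
by case: i => n; apply: iter_cones => //; exact: cones_inv.
Qed.

Lemma shift_int_cones (i : int) : preserves_cones (shift C i).
Proof. by apply: cones_pow => X Y Z u v w; exact: dist_sh_ex. Qed.

End ExactEquivalence.

(** * Exactness of the Serre functor *)
Section SerreExact.
Variables (k : fieldType) (C : triCat k) (S : serreFunctor C).
Implicit Types X Y Z T W : C.

(** Characterizes an isomorphism between (S X)[1] and S(X[1]) by its effect on
    traces. The sign compensates the one in the rotation of triangles. *)
Definition shift_compatible X (tau : dual (mor X (S X)))
    (tau' : dual (mor (sh C X) (S (sh C X))))
    (Phi : mor (sh C (S X)) (S (sh C X))) : Prop :=
  forall g : mor X (S X), tau' (Phi ∘ fmap (sh C) g) = - tau g.

(** Phi represents the functional which takes g[1] to - tau(g). It is invertible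
    because this functional and tau' both come from perfect pairings. *)
Lemma serre_shift X (tau : dual (mor X (S X)))
    (tau' : dual (mor (sh C X) (S (sh C X)))) :
  is_trace tau -> is_trace tau' ->
  exists2 Phi, is_iso Phi & shift_compatible tau tau' Phi.
Proof.
move=> tauE tauE'.
pose L := linfun (@fmap _ _ _ (sh C) X (S X)).
have [|psi psiE] := @functional_factor _ _ _ L (- tau : 'Hom(_, _)).
  move=> g; rewrite lfunE /= -(linear0 (@fmap _ _ _ (sh C) X (S X))).
  by move/aeq_faithful ->; rewrite linear0.
have [Phi PhiE] := trace_repr psi tauE'.
have compat : shift_compatible tau tau' Phi.
  by move=> g; have := psiE g; rewrite lfunE /= PhiE opp_lfunE.
exists Phi => //.
have Phi_inj T (a : mor T (sh C (S X))) : Phi ∘ a = 0 -> a = 0.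
  move=> Pa0; have [T' [i [j [ji ij]]]] := aeq_esurj (sh C) T.
  have [a' def_a'] := aeq_full (a ∘ i).
  have a'0 : a' = 0.
    apply: (trace_nondeg tauE) => g; apply: oppr_inj.
    by rewrite -compat fmapM -def_a' !compA Pa0 !comp0m oppr0 linear0.
  by rewrite -[a]compm1 -ij compA def_a' a'0 linear0 comp0m.
have [T' [i [j [ji ij]]]] := aeq_esurj (sh C) (S (sh C X)).
have [a' def_a'] := trace_repr (- (tau' \o linfun (mcomp i)
  \o linfun (@fmap _ _ _ (sh C) X T')) : 'Hom(_, _))%VF tauE.
have Pa' : Phi ∘ fmap (sh C) a' = i.
  apply: (trace_eq tauE') => g; have [g' ->] := aeq_full g.
  rewrite -compA -fmapM compat -def_a' opp_lfunE opprK.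
  by rewrite !comp_lfunE !lfunE.
have Pr : Phi ∘ (fmap (sh C) a' ∘ j) = idm _ by rewrite compA Pa' ij.
exists (fmap (sh C) a' ∘ j); split=> //.
apply/eqP; rewrite -subr_eq0; apply/eqP/Phi_inj.
by rewrite compmB compA Pr comp1m compm1 subrr.
Qed.

Lemma serre_shift_natural X Y (u : mor X Y)
    (tX : dual (mor X (S X))) (tX' : dual (mor (sh C X) (S (sh C X))))
    (tY : dual (mor Y (S Y))) (tY' : dual (mor (sh C Y) (S (sh C Y)))) PhiX PhiY :
  is_trace tX -> is_trace tX' -> is_trace tY -> is_trace tY' ->
  shift_compatible tX tX' PhiX -> shift_compatible tY tY' PhiY ->
  fmap S (fmap (sh C) u) ∘ PhiX = PhiY ∘ fmap (sh C) (fmap S u).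
Proof.
move=> tXE tXE' tYE tYE' cX cY; apply: (trace_eq tYE') => g.
have [h ->] := aeq_full g.
rewrite -!compA (trace_cyclic _ _ tXE' tYE') -compA -!fmapM cX cY.
by rewrite (trace_cyclic _ _ tXE tYE).
Qed.

(** Let W be a cone of S(u), with maps p and q. A map kap from W to S(Z) is the
    same as a functional psi on Hom(Z, W). The two squares that kap must make
    commute prescribe psi on p ∘ Hom(Z, S Y) and on Hom(X[1], W) ∘ w. If p ∘ z =
    x ∘ w then z and x are part of a morphism of triangles, whose third
    component shows that the two prescriptions agree. *)
Lemma serre_cones : preserves_cones S.
Proof.
move=> X Y Z u v w tri.
have [tX tXE] := trace_exists S X; have [tY tYE] := trace_exists S Y.
have [tZ tZE] := trace_exists S Z.
have [tX' tXE'] := trace_exists S (sh C X).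
have [tY' tYE'] := trace_exists S (sh C Y).
have [PhiX [PsiX [PsiPhi PhiPsi]] compX] := serre_shift tXE tXE'.
have [PhiY [PsiY [PsiPhiY PhiPsiY]] compY] := serre_shift tYE tYE'.
have PhiN := serre_shift_natural u tXE tXE' tYE tYE' compX compY.
have [W [p [q triW]]] := TR1_cone (fmap S u).
have [|psi [psi1 psi2]] := @functional_glue k _ _ _
    (linfun (@mcomp _ _ Z (S Y) W p)) (linfun (@precomp _ _ Z (sh C X) W w))
    (tY \o linfun (@precomp _ _ Y Z (S Y) v))%VF
    (tX' \o linfun (@mcomp _ _ (sh C X) W _ (PhiX ∘ q)))%VF.
  move=> z x; rewrite !comp_lfunE !lfunE /= /precomp => pz_xw.
  have [y [yu zv]] := TR3 (dist_rot (dist_rot tri)) (dist_rot triW) (esym pz_xw).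
  have [y0 def_y] := aeq_full y; rewrite {}def_y in yu zv.
  have {}zv : z ∘ v = fmap S u ∘ y0.
    apply: (@aeq_faithful _ _ (sh C)); apply: oppr_inj.
    by rewrite !fmapM -compmN zv compNm.
  rewrite zv (trace_cyclic _ _ tXE tYE) -compA -yu compmN -fmapM compmN.
  by rewrite linearN /= compX opprK.
have [kap kapE] := trace_repr psi tZE.
have kp : kap ∘ p = fmap S v.
  apply: (trace_eq tZE) => g; rewrite -compA -kapE.
  have := psi1 g; rewrite lfunE /= => ->.
  by rewrite comp_lfunE lfunE /= /precomp (trace_cyclic _ _ tYE tZE).
have wk : fmap S w ∘ kap = PhiX ∘ q.
  apply: (trace_eq tXE') => g; rewrite -compA (trace_cyclic _ _ tZE tXE') -compA.
  rewrite -kapE; have := psi2 g; rewrite lfunE /= /precomp => ->.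
  by rewrite comp_lfunE lfunE.
exists (PsiX ∘ fmap S w).
apply: (dist_of_exact (c := kap) triW) => [T b|T z wz0|||] //.
- exact: aeq_dist_lift tri.
- apply: (aeq_dist_lift (dist_rot tri)).
  by rewrite -[fmap S w]comp1m -PhiPsi -!compA (compA PsiX) wz0 compm0.
- rewrite -[fmap (sh C) _]comp1m -PsiPhiY -(compA PsiY) -PhiN.
  rewrite -!compA (compA PhiX) PhiPsi comp1m -fmapM (dist_comp0_sh tri).
  by rewrite linear0 compm0.
- by rewrite -compA wk compA PsiPhi comp1m.
Qed.

Lemma nu_cones (d : nat) : preserves_cones (nu_ S d).
Proof. by apply: cones_comp; [exact: serre_cones | exact: shift_int_cones]. Qed.

End SerreExact.

(** * Cluster tilting subcategories are stable under nu_d *)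
Section Stability.
Variables (k : fieldType) (C : triCat k) (S : serreFunctor C) (d : nat).
Implicit Types (X Y Z : C) (U V : C -> Prop).

Lemma shift_negK (n : nat) X :
  exists f : mor (shift C n (shift C (- (n%:Z)) X)) X, is_iso f.
Proof.
pose Q n := iter n (aeq_comp (aeq_inv (sh C))) (aeq_id C).
suff [f f_iso]: exists f : mor (shift C n (Q n X)) X, is_iso f.
  by case: n f f_iso => [|n] f f_iso; exists f.
elim: n => [|n [f f_iso]]; first by exists (idm X); exact: iso_idm.
have [t [t' [_ t't tt']]] := aeq_counit (sh C).
have t_iso : is_iso (t (Q n X)).
  by exists (t' (Q n X)); split; [exact: t't | exact: tt'].
rewrite -[shift C n.+1 _]/(sh C (shift C n (Q n.+1 X))) -shift_sh.
have /= g_iso := functor_iso (shift C n) t_iso.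
have [g [gf fg]] := f_iso; have [h [ht th]] := g_iso.
exists (f ∘ fmap (shift C n) (t (Q n X))), (h ∘ g); split.
  by rewrite -compA (compA g) gf comp1m ht.
by rewrite -compA (compA _ h) th comp1m fg.
Qed.

(** Hom(Y, nu_d(X)[i]) is dual to Hom(X, Y[d - i]), and i -> d - i preserves the
    range 1 <= i <= d - 1. *)
Lemma ct_nu U X : cluster_tilting d U -> (1 <= d)%N -> U X -> U (nu_ S d X).
Proof.
move=> ctU d1 UX; have [_ UE _] := ctU; apply/UE => i di Y UY.
have [f f_iso] := shift_negK d X.
pose X' := shift C (- (d%:Z)) X.
suff h : hom0 Y (shift C i (S X')) by exact: h.
have [Y' [g g_iso]] := aeq_esurj (shift C i) Y.
apply: (retract_hom0l (iso_retract_sym g_iso)).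
apply: (proj2 (hom0_aeq _ _ _)); apply: (proj1 (serre_hom0 _ _ _)).
apply: (proj1 (hom0_aeq (shift C d) _ _)).
apply: (retract_hom0l (iso_retract f_iso)).
have -> : d = (d - i + i)%N by lia.
rewrite shiftD.
apply: retract_hom0r (functor_retract (shift C (d - i)%N) (iso_retract g_iso)) _.
by apply: (ct_hom0 ctU) => //; lia.
Qed.

(** Hom(X, Y[i]) is dual to Hom(Y, nu_d(X)[d - i]). *)
Lemma ct_nu_inv U X : cluster_tilting d U -> (1 <= d)%N -> U (nu_ S d X) -> U X.
Proof.
move=> ctU d1 UX; have [_ _ UE] := ctU; apply/UE => i di Y UY.
have [f f_iso] := shift_negK d X.
pose X' := shift C (- (d%:Z)) X.
suff h : hom0 X (shift C i Y) by exact: h.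
have [T [g g_iso]] := aeq_esurj (shift C d) (shift C i Y).
apply: (retract_hom0l (iso_retract_sym f_iso)).
apply: (retract_hom0r (iso_retract_sym g_iso)).
apply: (proj2 (hom0_aeq _ _ _)); apply: (proj2 (serre_hom0 S _ _)).
apply: (proj1 (hom0_aeq (shift C (d - i)%N) _ _)).
have TY : retract (shift C (d - i)%N T) Y.
  apply: (@retract_aeq _ _ (shift C i)); rewrite -shiftD.
  have -> : (i + (d - i) = d)%N by lia.
  exact: iso_retract g_iso.
apply: (retract_hom0l TY).
by apply: (ct_hom0 ctU UY UX); lia.
Qed.

Lemma ct_nu_pow U (i : int) X : cluster_tilting d U -> (1 <= d)%N ->
  U X -> U (aeq_pow (nu_ S d) i X).
Proof.
move=> ctU d1 UX; case: i => n; first by elim: n => //= n; exact: ct_nu.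
rewrite /aeq_pow; elim: n.+1 => // m IH; apply: (ct_nu_inv ctU d1).
have [t [t' [_ t't tt']]] := aeq_counit (nu_ S d).
by apply: (ct_retract ctU _ IH); eexists (t _), (t' _); exact: t't.
Qed.

End Stability.

Theorem theorem2p8 (k : fieldType) (C : triCat k) (nu : serreFunctor C)
    (d : nat) (d_ge1 : (1 <= d)%N) (KS : krull_schmidt C) :
  ((exists2 U : C -> Prop,
      cluster_tilting d U & exists G : C, additive_generator U G) ->
   forall V : C -> Prop,
     cluster_tilting d V -> exists G : C, additive_generator V G)
  /\
  ((exists2 U : C -> Prop,
      cluster_tilting d U & exists G : C, nu_additive_generator nu d U G) ->
   forall V : C -> Prop,
     cluster_tilting d V -> exists G : C, nu_additive_generator nu d V G).
Proof.
split=> -[U ctU [G [UG UE]]] V ctV.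
all: have [||W [VW cW]] := @ct_coresolution _ _ d V d.-1 0 G ctV;
  [by rewrite addn0 | by case |].
- exists W; split=> //.
  apply: (cluster_tilting_generated d_ge1 ctU ctV (fun X => proj1 (UE X)))
    => [X -> //|_ ->].
  apply: coresolvable_sub cW => X XW.
  by apply: add_closure_retract XW _; exact: add_closure_incl.
- exists W; split=> //.
  apply: (cluster_tilting_generated d_ge1 ctU ctV (fun X => proj1 (UE X))).
  + by move=> X [i ->]; exact: ct_nu_pow.
  + move=> _ [i ->].
    apply: coresolvable_map cW => [|X /(functor_retract (aeq_pow (nu_ nu d) i)) XW].
      by apply: cones_pow; exact: nu_cones.
    by apply: add_closure_retract XW _; apply: add_closure_incl; exists i.
Qed.
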